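(* There are universal constants $C_1,C_2,C_3,C_4>0$ such that the following holds. Fix $\varepsilon\in(0,1)$ and $\delta\in(0,1)$ and suppose $H\ge5$. In the unknown transition setting, let $\overline\pi$ be the output policy of MB-TAIL. Assume that the optimization error satisfies $\varepsilon_{\mathrm{opt}}\le\varepsilon/2$, the number of iterations satisfies $T\ge C_1|\mathcal S||\mathcal A|H^2/\varepsilon^2$, and the step size is $\eta^{(t)}=\sqrt{|\mathcal S||\mathcal A|/(8T)}$. If the number $m$ of expert trajectories, the number $n'$ of interaction trajectories for estimation, and the number $n$ of interaction trajectories for reward-free exploration satisfy $$m\ge C_2\frac{|\mathcal S|H^{3/2}}{\varepsilon}\log\Bigl(\frac{|\mathcal S|H}{\delta}\Bigr),\qquad n'\ge C_3\frac{|\mathcal S|H^2}{\varepsilon^2}\log\Bigl(\frac{|\mathcal S|H}{\delta}\Bigr),\qquad n\ge C_4\frac{|\mathcal S||\mathcal A|H^3}{\varepsilon^2}\Bigl(|\mathcal S|+\log\Bigl(\frac{|\mathcal S||\mathcal A|H}{\delta\varepsilon}\Bigr)\Bigr),$$ then with probability at least $1-\delta$, $V^{\pi^{E}}-V^{\overline\pi}\le\varepsilon$.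
   Context: A tabular episodic MDP is a tuple $(\mathcal S,\mathcal A,P,r,H,\rho)$ with finite $\mathcal S,\mathcal A$, horizon $H$, time-dependent transitions $P=(P_1,\dots,P_H)$, rewards $r_h:\mathcal S\times\mathcal A\to[0,1]$, and initial distribution $\rho$. $\Pi$ is the set of all non-stationary stochastic policies. $V^{\pi,Q,w}$ is the expected total reward over $H$ steps of $\pi$ under transitions $Q$ and (time-dependent) reward $w$; $V^\pi=V^{\pi,P,r}$. $P^{\pi,Q}_h(s,a)$ is the probability of $(s_h,a_h)=(s,a)$ under $\pi$ and transitions $Q$. The expert $\pi^{E}$ is deterministic; $\mathcal D$ consists of $m$ i.i.d. length-$H$ expert trajectories. In the unknown transition setting the learner does not know $P$ but may roll out policies for whole episodes in the environment. MB-TAIL: (1) Randomly split $\mathcal D=\mathcal D_1\cup\mathcal D_1^c$ into two halves of equal size. Let $\mathcal S_h(\mathcal D_1)$ be the states visited at step $h$ in $\mathcal D_1$, $\Pi_{\mathrm{BC}}(\mathcal D_1)$ the set of policies taking the expert action (with probability one) at every $h$ and $s\in\mathcal S_h(\mathcal D_1)$, and $\mathbf{Tr}^{\mathcal D_1}_h$ the set of truncated trajectories $\mathrm{tr}_h=(s_1,a_1,\dots,s_h,a_h)$ with $s_\ell\in\mathcal S_\ell(\mathcal D_1)$ for all $\ell\le h$; $\mathrm{tr}_h(s_h,a_h)$ denotes the step-$h$ pair. (2) Take $\pi\in\Pi_{\mathrm{BC}}(\mathcal D_1)$ and roll it out to get a dataset $\mathcal D'_{\mathrm{env}}$ of $n'$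 i.i.d. trajectories. (3) Form, truncating trajectories at step $h$, $$\widetilde P^{\pi^{E}}_h(s,a)=\frac{\sum_{\mathrm{tr}_h\in\mathcal D'_{\mathrm{env}}}\mathbb I\{\mathrm{tr}_h(s_h,a_h)=(s,a),\mathrm{tr}_h\in\mathbf{Tr}^{\mathcal D_1}_h\}}{|\mathcal D'_{\mathrm{env}}|}+\frac{\sum_{\mathrm{tr}_h\in\mathcal D_1^c}\mathbb I\{\mathrm{tr}_h(s_h,a_h)=(s,a),\mathrm{tr}_h\notin\mathbf{Tr}^{\mathcal D_1}_h\}}{|\mathcal D_1^c|}.$$ (4) Run the reward-free exploration method RF-Express (Ménard et al.) to collect $n$ trajectories and build an empirical transition function $\widehat P$. Its known guarantee: there is a universal constant $c$ such that for $\varepsilon',\delta'\in(0,1)$, if $n\ge c\frac{|\mathcal S||\mathcal A|H^3}{\varepsilon'^2}(|\mathcal S|+\log(|\mathcal S|H/\delta'))$, then with probability at least $1-\delta'$, $|V^{\pi,P,w}-V^{\pi,\widehat P,w}|\le\varepsilon'/2$ for all policies $\pi$ and all rewards $w$ with values in $[-1,1]$. (5) Run TAIL with $\widetilde P^{\pi^{E}}$ under the model $\widehat P$: let $\mathcal W=\{w=(w_h(s,a)):\|w\|_\infty\le1\}$ and start from $w^{(1)}\in\mathcal W$. For $t=1,\dots,T$: let $\pi^{(t)}$ be an optimal policy for reward $w^{(t)}$ under $\widehat P$ up to error $\varepsilon_{\mathrm{opt}}$, i.e. $V^{\pi^{(t)},\widehat P,w^{(t)}}\ge\max_\pi V^{\pi,\widehat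 P,w^{(t)}}-\varepsilon_{\mathrm{opt}}$; set $f^{(t)}(w)=\sum_h\sum_{(s,a)}w_h(s,a)\bigl(P^{\pi^{(t)},\widehat P}_h(s,a)-\widetilde P^{\pi^{E}}_h(s,a)\bigr)$ and $w^{(t+1)}=\mathrm{Proj}_{\mathcal W}(w^{(t)}-\eta^{(t)}\nabla f^{(t)}(w^{(t)}))$ (Euclidean projection). Let $\overline P_h(s,a)=\frac1T\sum_tP^{\pi^{(t)},\widehat P}_h(s,a)$ and output $\overline\pi_h(a|s)=\overline P_h(s,a)/\sum_{a'}\overline P_h(s,a')$ (arbitrary where the denominator is zero). *)

(* Defs.v *)
From HB Require Import structures.
From mathcomp Require Import all_boot all_order all_algebra.
From mathcomp Require Import all_classical all_reals all_analysis.

Set Implicit Arguments.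
Unset Strict Implicit.
Unset Printing Implicit Defensive.

Import Order.TTheory GRing.Theory Num.Theory.
Import numFieldNormedType.Exports.
Local Open Scope ring_scope.

(** * Finite probability *)

Record fdist (R : realType) (T : finType) := FDist {
  fdist_fun :> T -> R;
  fdist_ge0 : forall x, 0 <= fdist_fun x;
  fdist_sum1 : \sum_x fdist_fun x = 1 }.

Lemma dirac_ge0 (R : realType) (T : finType) (x y : T) :
  0 <= (y == x)%:R :> R.
Proof. exact: ler0n. Qed.

Lemma dirac_sum1 (R : realType) (T : finType) (x : T) :
  \sum_y (y == x)%:R = 1 :> R.
Proof.
rewrite (bigD1 x) //= eqxx big1 ?addr0 // => y /negbTE ->.
by [].
Qed.

Definition fdirac (R : realType) (T : finType) (x : T) : fdist R T :=
  FDist (@dirac_ge0 R T x) (@dirac_sum1 R T x).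

Definition Pr (R : realType) (T : finType) (p : T -> R) (E : T -> Prop) : R :=
  \sum_(x | `[< E x >]) p x.

(** * Episodic MDPs

  Steps 1, ..., H are indexed by ['I_H], i.e. by 0, ..., H-1. *)

Definition policy (R : realType) (S A : finType) (H : nat) :=
  'I_H -> S -> fdist R A.

(* [Q h s a] is the law of the state at step [h + 1]; its value at the last
   step is never used. *)
Definition transitions (R : realType) (S A : finType) (H : nat) :=
  'I_H -> S -> A -> fdist R S.

Definition rewards (R : realType) (S A : finType) (H : nat) :=
  'I_H -> S -> A -> R.

Record mdp (R : realType) (S A : finType) (H : nat) := MDP {
  trans : transitions R S A H;
  reward : rewards R S A H;
  init : fdist R S;
  reward_itv : forall h s a, 0 <= reward h s a <= 1 }.

Definition traj (S A : finType) (H : nat) := {ffun 'I_H -> S * A}.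

(* The probability of a trajectory is
   rho(s_1) * prod_h pi_h(a_h | s_h) * prod_(h < H) Q_h(s_(h+1) | s_h, a_h);
   the inner product over [k] with [k = h + 1] is over one index, or is empty
   at the last step. *)
Definition traj_pr (R : realType) (S A : finType) (H : nat)
    (rho : fdist R S) (Q : transitions R S A H) (pi : policy R S A H)
    (tau : traj S A H) : R :=
  (\prod_(h < H | h == 0%N :> nat) rho (tau h).1) *
  (\prod_(h < H) pi h (tau h).1 (tau h).2) *
  \prod_(h < H) \prod_(k < H | k == h.+1 :> nat)
     Q h (tau h).1 (tau h).2 (tau k).1.

(* V^{pi,Q,w} *)
Definition value (R : realType) (S A : finType) (H : nat)
    (rho : fdist R S) (Q : transitions R S A H) (w : rewards R S A H)
    (pi : policy R S A H) : R :=
  \sum_(tau : traj S A H)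
     traj_pr rho Q pi tau * \sum_(h < H) w h (tau h).1 (tau h).2.

(* P^{pi,Q}_h(s,a) *)
Definition occupancy (R : realType) (S A : finType) (H : nat)
    (rho : fdist R S) (Q : transitions R S A H) (pi : policy R S A H)
    (h : 'I_H) (s : S) (a : A) : R :=
  Pr (traj_pr rho Q pi) (fun tau => tau h = (s, a)).

Definition det_policy (R : realType) (S A : finType) (H : nat)
    (piE : 'I_H -> S -> A) : policy R S A H :=
  fun h s => fdirac R (piE h s).

(* The set W of weight functions with sup norm at most 1. *)
Definition in_W (R : realType) (S A : finType) (H : nat)
    (w : rewards R S A H) : Prop :=
  forall h s a, `|w h s a| <= 1.

(** * Datasets *)

(* S_h(D1) *)
Definition visited (S A : finType) (H : nat)
    (D1 : seq (traj S A H)) (h : 'I_H) : {set S} :=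
  [set s | has (fun tau : traj S A H => (tau h).1 == s) D1].

Definition in_PiBC (R : realType) (S A : finType) (H : nat)
    (piE : 'I_H -> S -> A) (D1 : seq (traj S A H)) (pi : policy R S A H) :
    Prop :=
  forall h s, s \in visited D1 h -> pi h s (piE h s) = 1.

(* The truncation of [tau] at step [h] belongs to Tr_h^{D1}. *)
Definition in_Tr (S A : finType) (H : nat)
    (D1 : seq (traj S A H)) (h : 'I_H) (tau : traj S A H) : bool :=
  [forall l : 'I_H, (l <= h)%N ==> ((tau l).1 \in visited D1 l)].

(* The estimator of P^{pi^E}; [Denv] is D'_env and [D1c] is D_1^c. *)
Definition Ptilde (R : realType) (S A : finType) (H : nat)
    (D1 D1c Denv : seq (traj S A H)) (h : 'I_H) (s : S) (a : A) : R :=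
  (count (fun tau : traj S A H => (tau h == (s, a)) && in_Tr D1 h tau)
     Denv)%:R / (size Denv)%:R +
  (count (fun tau : traj S A H => (tau h == (s, a)) && ~~ in_Tr D1 h tau)
     D1c)%:R / (size D1c)%:R.

(** * Reward-free exploration *)

Definition ntrans (S A : finType) (H : nat) (E : seq (traj S A H))
    (h : 'I_H) (s : S) (a : A) (s' : S) : nat :=
  count (fun tau : traj S A H => (tau h == (s, a)) &&
           [exists k : 'I_H, (k == h.+1 :> nat) && ((tau k).1 == s')]) E.

(* Empirical transition frequencies, uniform if (s, a) was not visited. *)
Definition Phat_fun (R : realType) (S A : finType) (H : nat)
    (E : seq (traj S A H)) (h : 'I_H) (s : S) (a : A) (s' : S) : R :=
  let N := (\sum_x ntrans E h s a x)%N in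
  if N == 0%N then (#|S|%:R)^-1 else (ntrans E h s a s')%:R / N%:R.

Lemma Phat_ge0 (R : realType) (S A : finType) (H : nat)
    (E : seq (traj S A H)) (h : 'I_H) (s : S) (a : A) (s' : S) :
  0 <= Phat_fun R E h s a s'.
Proof.
by rewrite /Phat_fun; case: ifP => _; rewrite ?divr_ge0 ?invr_ge0 ?ler0n.
Qed.

Lemma Phat_sum1 (R : realType) (S A : finType) (H : nat)
    (E : seq (traj S A H)) (h : 'I_H) (s : S) (a : A) :
  \sum_s' Phat_fun R E h s a s' = 1.
Proof.
rewrite /Phat_fun; case: eqVneq => [_|N0].
  rewrite sumr_const -[_ *+ _]mulr_natr mulVf // pnatr_eq0 -lt0n.
  by apply/card_gt0P; exists s.
by rewrite -mulr_suml -natr_sum mulfV // pnatr_eq0.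
Qed.

Definition Phat (R : realType) (S A : finType) (H : nat)
    (E : seq (traj S A H)) : transitions R S A H :=
  fun h s a => FDist (Phat_ge0 R E h s a) (Phat_sum1 R E h s a).

(* A sampling rule chooses the policy of the next episode from the
   trajectories of the past ones. *)
Definition sampling_rule (R : realType) (S A : finType) (H : nat) :=
  seq (traj S A H) -> policy R S A H.

(* Joint law of the first [n] episodes under a sampling rule. *)
Definition explore_pr (R : realType) (S A : finType) (H : nat)
    (M : mdp R S A H) (rule : sampling_rule R S A H) (n : nat)
    (E : n.-tuple (traj S A H)) : R :=
  \prod_(i < n) traj_pr (init M) (trans M) (rule (take i E)) (tnth E i).

(* The guarantee of reward-free exploration with constant [c] in the MDP [M],
   for a method whose sampling rule takes the confidence parameter
   [delta'] as input (as that of RF-Express does). *)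
Definition reward_free_guarantee (R : realType) (S A : finType) (H : nat)
    (c : R) (M : mdp R S A H) (rfe : R -> sampling_rule R S A H) : Prop :=
  forall (eps' delta' : R) (n : nat),
    0 < eps' < 1 -> 0 < delta' < 1 ->
    c * (#|S|%:R * #|A|%:R * H%:R ^+ 3 / eps' ^+ 2) *
      (#|S|%:R + ln (#|S|%:R * H%:R / delta')) <= n%:R ->
    1 - delta' <=
    Pr (@explore_pr R S A H M (rfe delta') n) (fun E =>
      forall (pi : policy R S A H) (w : rewards R S A H), in_W w ->
        `|value (init M) (trans M) w pi - value (init M) (Phat R E) w pi|
          <= eps' / 2).

(** * TAIL *)

(* Vector of partial derivatives. *)
Definition gradient (R : realType) (S A : finType) (H : nat)
    (f : rewards R S A H -> R) (w : rewards R S A H) : rewards R S A H :=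
  fun h s a =>
    derive1 (fun x : R =>
      f (fun h' s' a' => w h' s' a' +
           (if (h', s', a') == (h, s, a) then x else 0))) 0.

Definition edist (R : realType) (S A : finType) (H : nat)
    (u v : rewards R S A H) : R :=
  Num.sqrt (\sum_h \sum_s \sum_a (u h s a - v h s a) ^+ 2).

(* [p] is the Euclidean projection of [x] on W. *)
Definition is_proj_W (R : realType) (S A : finType) (H : nat)
    (x p : rewards R S A H) : Prop :=
  in_W p /\ forall u, in_W u -> edist x p <= edist x u.

(* [pibar] is a possible output of TAIL run with model [Q] and estimator [Pt].
   Iterations are indexed from 0: [w t], [pi t], [eta t] stand for w^(t+1),
   pi^(t+1), eta^(t+1). *)
Definition TAIL_output (R : realType) (S A : finType) (H : nat)
    (rho : fdist R S) (Q : transitions R S A H) (Pt : 'I_H -> S -> A -> R)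
    (eps_opt : R) (T : nat) (eta : nat -> R) (pibar : policy R S A H) : Prop :=
  exists (w : nat -> rewards R S A H) (pi : nat -> policy R S A H),
  [/\ in_W (w 0%N),
      forall t, (t < T)%N -> forall pi' : policy R S A H,
        value rho Q (w t) (pi t) >= value rho Q (w t) pi' - eps_opt,
      forall t, (t < T)%N ->
        let f (v : rewards R S A H) : R :=
          \sum_h \sum_s \sum_a
             v h s a * (occupancy rho Q (pi t) h s a - Pt h s a) in
        is_proj_W
          (fun h s a => w t h s a - eta t * gradient f (w t) h s a)
          (w t.+1)
    & let Pbar h s a : R :=
        T%:R^-1 * \sum_(t < T) occupancy rho Q (pi t) h s a in
      forall h s a, \sum_a' Pbar h s a' != 0 ->
        pibar h s a = Pbar h s a / \sum_a' Pbar h s a'].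

(** * MB-TAIL *)

(* The random data: the expert trajectories, the indices of those put in D1,
   D'_env, and the trajectories collected by reward-free exploration. *)
Definition mbtail_data (S A : finType) (H m n' n : nat) : Type :=
  (m.-tuple (traj S A H) * {set 'I_m} *
   n'.-tuple (traj S A H) * n.-tuple (traj S A H))%type.

Definition subsample (S A : finType) (H m : nat)
    (D : m.-tuple (traj S A H)) (B : {set 'I_m}) : seq (traj S A H) :=
  [seq tnth D i | i <- enum B].

(* Joint law of the data. [bc D1] is the policy chosen in Pi_BC(D1). *)
Definition mbtail_pr (R : realType) (S A : finType) (H : nat)
    (M : mdp R S A H) (piE : 'I_H -> S -> A)
    (bc : seq (traj S A H) -> policy R S A H)
    (rule : sampling_rule R S A H) (m n' n : nat)
    (omega : mbtail_data S A H m n' n) : R :=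
  let: (D, B, Denv, E) := omega in
  (\prod_(i < m) traj_pr (init M) (trans M) (det_policy R piE) (tnth D i)) *
  ((#|B| == m./2)%:R / 'C(m, m./2)%:R) *
  (\prod_(i < n') traj_pr (init M) (trans M) (bc (subsample D B))
                    (tnth Denv i)) *
  explore_pr M rule E.

(* [pibar] is a possible output policy of MB-TAIL on the data [omega]. *)
Definition MBTAIL_output (R : realType) (S A : finType) (H : nat)
    (rho : fdist R S) (eps_opt : R) (T : nat) (eta : nat -> R) (m n' n : nat)
    (omega : mbtail_data S A H m n' n) (pibar : policy R S A H) : Prop :=
  let: (D, B, Denv, E) := omega in
  TAIL_output rho (Phat R E)
    (Ptilde R (subsample D B) (subsample D (~: B)) Denv)
    eps_opt T eta pibar.

(* Main.v *)
Require Import Defs.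
From HB Require Import structures.
From mathcomp Require Import all_boot all_order all_algebra.
From mathcomp Require Import all_classical all_reals all_analysis.
From mathcomp Require Import ring lra.

Set Implicit Arguments.
Unset Strict Implicit.
Unset Printing Implicit Defensive.

Import Order.TTheory GRing.Theory Num.Theory.
Local Open Scope ring_scope.

(** The loss of the output policy is split as follows. Projected gradient
  descent on [f^(t)] has small regret against the true reward, and each
  [pi^(t)] nearly beats the expert in the learned model; as the average
  occupancy solves the flow equations of that model, it is the occupancy of the
  output policy. Hence the loss is at most twice the l1 error of the estimator
  of [P^{pi^E}], plus the model, optimization and regret errors.

  The l1 error is controlled by the bound
  [|N^-1 sum_i X_i - q| <= lam q + ln / (lam N)] for a Bernoulli mean [q],
  valid for every fixed [lam] in (0, 1/3]. On [Tr_h^{D1}] any policy in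
  [Pi_BC(D1)] has the law of the expert, and [lam ~ eps / H] is used for the
  rollouts; off [Tr_h^{D1}] the total mass is at most [H |S| ln / m] with high
  probability, so [lam ~ H^{-1/2}] yields the rate [H^{3/2} |S| / m]. *)

(** * Path laws built from adapted kernels *)

(** The law of a trajectory is a flat product over all steps, without conditional probabilities.
    Whatever refers to the past (flow equations, exchanging one policy for another up to step [h])
    needs marginals of such products. They are obtained by rewriting the product with adapted
    kernels and freezing late coordinates at a point instead of removing them, so that all laws live
    on the same paths.

    The set [Tr_h^{D1}] and the rollout policy are themselves random. For a fixed split, the other
    expert half is independent of D1, and given D1 the rollouts are i.i.d.; deviations can thus be
    bounded for fixed events.

    The deviation bound is linear in [q], so summing it over states needs only total masses and no
    Cauchy-Schwarz step. Off [Tr_h^{D1}] the sum at one step is proportional to [lam H + 1 / lam],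
    which explains [lam ~ H^{-1/2}]. The estimator charges only expert actions, which is why neither
    [m] nor [n'] depends on the number of actions. *)

Section AdaptedKernels.
Variables (R : realType) (X : finType) (H : nat).
Local Notation path := {ffun 'I_H -> X}.
Implicit Types (tau : path) (j : 'I_H).

Definition upd tau j (x : X) : path :=
  [ffun l => if l == j then x else tau l].

(** Swapping coordinate [j] with the fresh value [x] is an involution of [path * X]; after this
    reindexing the weight [d] depends on [x] alone and sums out. *)
Lemma sum_upd (d : X -> R) j (Phi : path -> R) :
  \sum_x d x = 1 ->
  \sum_(tau : path) Phi tau =
  \sum_(tau : path) d (tau j) * \sum_x Phi (upd tau j x).
Proof.
move=> d1; under [RHS]eq_bigr do rewrite big_distrr /=.
rewrite pair_big /=.
pose swap (u : path * X) := (upd u.1 j u.2, u.1 j).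
have swapK : involutive swap.
  case=> tau x; rewrite /swap /=; congr pair; last by rewrite ffunE eqxx.
  by apply/ffunP => l; rewrite !ffunE; case: eqP => [->|].
rewrite (reindex_inj (inv_inj swapK)) /=.
rewrite -(pair_big xpredT xpredT (fun tau x =>
  d (upd tau j x j) * Phi (upd (upd tau j x) j (tau j)))) /=.
apply: eq_bigr => tau _.
rewrite (eq_bigr (fun x => d x * Phi tau)) => [|x _].
  by rewrite -big_distrl /= d1 mul1r.
rewrite ffunE eqxx; congr (_ * Phi _).
by apply/ffunP => l; rewrite !ffunE; case: eqP => [->|].
Qed.

Definition depends_below (V : Type) (n : nat) (G : path -> V) :=
  forall tau tau', (forall l : 'I_H, (l < n)%N -> tau l = tau' l) ->
    G tau = G tau'.

Variable K : 'I_H -> path -> X -> R.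
Hypothesis K_adapted : forall j x, depends_below j (K j ^~ x).
Hypothesis K_sum1 : forall j tau, \sum_x K j tau x = 1.
Variable x0 : X.

(* The first [n] coordinates follow the kernels, the other ones are pinned
   at [x0]. *)
Definition trunc_law (n : nat) tau : R :=
  \prod_(k < H) (if (k < n)%N then K k tau (tau k) else (tau k == x0)%:R).

(** The point mass that pins coordinate [j] is the weight [d] of [sum_upd]. By adaptedness the
    kernels up to [j] do not see the new value. *)
Lemma trunc_law_step j (Phi : path -> R) :
  \sum_(tau : path) trunc_law j.+1 tau * Phi tau =
  \sum_(tau : path) trunc_law j tau * \sum_x K j tau x * Phi (upd tau j x).
Proof.
rewrite (@sum_upd (fun x => (x == x0)%:R) j); last first.
  by rewrite -[RHS](dirac_sum1 R x0).
apply: eq_bigr => tau _; rewrite [in RHS]/trunc_law (bigD1 j) //= ltnn.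
rewrite -mulrA; congr (_ * _); rewrite big_distrr /=.
apply: eq_bigr => x _; rewrite /trunc_law (bigD1 j) //= leqnn ffunE eqxx.
rewrite (@K_adapted j x (upd tau j x) tau) => [|l lj]; last first.
  by rewrite ffunE -val_eqE /= ltn_eqF.
rewrite -mulrA [RHS]mulrCA; congr (_ * (_ * _)).
apply: eq_bigr => k kj.
have kj' : (k < j.+1)%N = (k < j)%N by rewrite ltnS leq_eqVlt val_eqE (negbTE kj).
rewrite kj' ffunE (negbTE kj); case: ifP => // lkj.
apply: K_adapted => l lk; rewrite ffunE -val_eqE /= ltn_eqF //.
exact: ltn_trans lkj.
Qed.

(** Coordinates are integrated out backwards from the last one: [G] ignores them and each kernel has
    mass 1. *)
Lemma trunc_law_marginal (n : nat) (G : path -> R) :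
  (n <= H)%N -> depends_below n G ->
  \sum_(tau : path) trunc_law H tau * G tau =
  \sum_(tau : path) trunc_law n tau * G tau.
Proof.
move=> nH Gn; suff IH i : (i <= H - n)%N ->
    \sum_(tau : path) trunc_law H tau * G tau =
    \sum_(tau : path) trunc_law (H - i) tau * G tau.
  by rewrite (IH (H - n)%N) // subKn.
elim: i => [|i IHi] iHn; first by rewrite subn0.
have iH : (i < H)%N by apply: leq_trans iHn (leq_subr _ _).
have jH : (H - i.+1 < H)%N by rewrite ltn_subrL (leq_ltn_trans _ iH).
rewrite IHi; last exact: ltnW.
have -> : (H - i)%N = (Ordinal jH).+1 by rewrite /= subnSK.
rewrite trunc_law_step; apply: eq_bigr => tau _; congr (_ * _).
rewrite (eq_bigr (fun x => K (Ordinal jH) tau x * G tau)) => [|x _].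
  by rewrite -big_distrl /= K_sum1 mul1r.
congr (_ * _); apply: Gn => l ln; rewrite ffunE -val_eqE /= ltn_eqF //.
by apply: leq_trans ln _; rewrite leq_subRL // addnC -leq_subRL.
Qed.

Lemma trunc_law_total : \sum_(tau : path) trunc_law H tau = 1.
Proof.
have -> : \sum_(tau : path) trunc_law H tau =
    \sum_(tau : path) trunc_law H tau * 1 by apply: eq_bigr => *; rewrite mulr1.
rewrite (@trunc_law_marginal 0 (fun=> 1)) //.
rewrite (bigD1 [ffun=> x0]) //= mulr1 [X in _ + X]big1 ?addr0 => [|tau tau0].
  by rewrite /trunc_law big1 // => k _; rewrite ffunE eqxx.
apply/eqP; rewrite mulr1 /trunc_law prodf_seq_eq0 /=.
apply/hasP; move: tau0; apply: contraNP => tau0; apply/eqP/ffunP => k.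
rewrite ffunE; apply/eqP; apply: contra_notT tau0 => tauk.
by exists k; rewrite ?mem_index_enum // (negbTE tauk).
Qed.

(** The tower property, conditionally on the steps before [j]. *)
Lemma trunc_law_disintegrate j (G : path -> R) (phi : X -> R) :
  depends_below j G ->
  \sum_(tau : path) trunc_law H tau * (G tau * phi (tau j)) =
  \sum_(tau : path) trunc_law H tau * (G tau * \sum_x K j tau x * phi x).
Proof.
move=> Gj; rewrite (@trunc_law_marginal j.+1) //; last first.
  move=> tau tau' E; congr (_ * phi _); last exact: E.
  by apply: Gj => l lj; apply: E; apply: ltnW.
rewrite trunc_law_step (@trunc_law_marginal j) //; first last.
- move=> tau tau' E; congr (_ * _); first exact: Gj.
  by apply: eq_bigr => x _; congr (_ * _); apply: K_adapted.
- exact: ltnW.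
apply: eq_bigr => tau _; congr (_ * _); rewrite big_distrr /=.
apply: eq_bigr => x _; rewrite mulrCA; congr (_ * (_ * phi _)).
  by apply: Gj => l lj; rewrite ffunE -val_eqE /= ltn_eqF.
by rewrite ffunE eqxx.
Qed.

End AdaptedKernels.

(** * Occupancy measures *)

Section Occupancy.
Variables (R : realType) (S A : finType) (H : nat).
Local Notation path := (traj S A H).
Variables (rho : fdist R S) (Q : transitions R S A H).
Implicit Types (tau : path) (j k h : 'I_H) (pi : policy R S A H).

(** Law of the state at step [k] given the past. One factor is always trivial: the product is empty
    at the first step and has the single index [k - 1] afterwards. *)
Definition state_kernel k tau (s : S) : R :=
  (if k == 0%N :> nat then rho s else 1) *
  \prod_(h < H | k == h.+1 :> nat) Q h (tau h).1 (tau h).2 s.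

Definition step_kernel pi k tau (x : S * A) : R :=
  state_kernel k tau x.1 * pi k x.1 x.2.

Lemma state_kernel0 k tau s : k = 0%N :> nat -> state_kernel k tau s = rho s.
Proof.
by move=> k0; rewrite /state_kernel k0 eqxx big_pred0 ?mulr1 // => h.
Qed.

Lemma state_kernelS h k tau s :
  k = h.+1 :> nat -> state_kernel k tau s = Q h (tau h).1 (tau h).2 s.
Proof.
by move=> kh; rewrite /state_kernel kh /= mul1r (big_pred1 h).
Qed.

Lemma state_kernelP k :
  k = 0%N :> nat \/ exists h : 'I_H, k = h.+1 :> nat.
Proof.
case: k => -[|k] kH; first by left.
by right; exists (Ordinal (ltnW kH)).
Qed.

Lemma step_kernel_adapted pi k x :
  depends_below k (step_kernel pi k ^~ x).
Proof.
move=> tau tau' E; rewrite /step_kernel; congr (_ * _).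
have [k0|[h kh]] := state_kernelP k; first by rewrite !state_kernel0.
by rewrite !(state_kernelS _ _ kh) E // kh.
Qed.

Lemma step_kernel_marginal pi k tau (s : S) :
  \sum_a step_kernel pi k tau (s, a) = state_kernel k tau s.
Proof. by rewrite /step_kernel /= -big_distrr /= fdist_sum1 mulr1. Qed.

Lemma step_kernel_sum1 pi k tau : \sum_x step_kernel pi k tau x = 1.
Proof.
rewrite (eq_bigr (fun x => step_kernel pi k tau (x.1, x.2))); last by move=> [].
rewrite -(pair_big xpredT xpredT (fun s a => step_kernel pi k tau (s, a))) /=.
under eq_bigr do rewrite step_kernel_marginal.
have [k0|[h kh]] := state_kernelP k.
  by under eq_bigr do rewrite state_kernel0 //; rewrite fdist_sum1.
by under eq_bigr do rewrite (state_kernelS _ _ kh); rewrite fdist_sum1.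
Qed.

(** Each transition factor is regrouped under its arrival step, which makes the product adapted. *)
Lemma traj_prE pi tau :
  traj_pr rho Q pi tau = \prod_(k < H) step_kernel pi k tau (tau k).
Proof.
rewrite /traj_pr [X in _ * X](exchange_big_dep xpredT) //=.
rewrite [X in X * _ * _]big_mkcond.
rewrite -!big_split /=; apply: eq_bigr => k _.
by rewrite /step_kernel /state_kernel mulrAC.
Qed.

Lemma traj_pr_trunc pi x0 tau :
  traj_pr rho Q pi tau = trunc_law (step_kernel pi) x0 H tau.
Proof.
by rewrite traj_prE; apply: eq_bigr => k _; rewrite ltn_ord.
Qed.

Lemma traj_pr_ge0 pi tau : 0 <= traj_pr rho Q pi tau.
Proof.
rewrite /traj_pr !mulr_ge0 //; apply: prodr_ge0 => k _; rewrite ?fdist_ge0 //.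
by apply: prodr_ge0 => h _; rewrite fdist_ge0.
Qed.

Lemma traj_pr_sum1 pi (x0 : S * A) : \sum_tau traj_pr rho Q pi tau = 1.
Proof.
under eq_bigr do rewrite (traj_pr_trunc pi x0).
apply: trunc_law_total => *; [exact: step_kernel_adapted|].
exact: step_kernel_sum1.
Qed.

Lemma PrE (T : finType) (p : T -> R) (E : T -> Prop) :
  Pr p E = \sum_x p x * `[< E x >]%:R.
Proof.
rewrite /Pr big_mkcond; apply: eq_bigr => x _.
by case: ifP; rewrite ?mulr1 ?mulr0.
Qed.

Lemma occupancyE pi h s a :
  occupancy rho Q pi h s a = \sum_tau traj_pr rho Q pi tau * (tau h == (s, a))%:R.
Proof.
rewrite /occupancy PrE; apply: eq_bigr => tau _; congr (_ * (nat_of_bool _)%:R).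
by apply/asboolP/eqP.
Qed.

Lemma occupancy_ge0 pi h s a : 0 <= occupancy rho Q pi h s a.
Proof.
by rewrite occupancyE sumr_ge0 // => tau _; rewrite mulr_ge0 ?traj_pr_ge0.
Qed.

Definition state_occupancy pi h s : R := \sum_a occupancy rho Q pi h s a.

Lemma occupancy_kernel pi k s a :
  occupancy rho Q pi k s a =
  (\sum_tau traj_pr rho Q pi tau * state_kernel k tau s) * pi k s a.
Proof.
rewrite occupancyE big_distrl /=.
transitivity (\sum_(tau : path) trunc_law (step_kernel pi) (s, a) H tau *
    (1 * (tau k == (s, a))%:R)).
  by apply: eq_bigr => tau _; rewrite -traj_pr_trunc mul1r.
rewrite (trunc_law_disintegrate (@step_kernel_adapted pi)
  (@step_kernel_sum1 pi) _ (fun x => (x == (s, a))%:R)) //.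
apply: eq_bigr => tau _; rewrite -traj_pr_trunc mul1r -mulrA; congr (_ * _).
rewrite (bigD1 (s, a)) //= eqxx mulr1 big1 ?addr0 // => x /negbTE ->.
by rewrite mulr0.
Qed.

Lemma occupancy_policy pi k s a :
  occupancy rho Q pi k s a = state_occupancy pi k s * pi k s a.
Proof.
rewrite /state_occupancy; under [X in X * _]eq_bigr do rewrite occupancy_kernel.
by rewrite -big_distrr /= fdist_sum1 mulr1 occupancy_kernel.
Qed.

Lemma state_occupancy_kernel pi k s : state_occupancy pi k s =
  \sum_tau traj_pr rho Q pi tau * state_kernel k tau s.
Proof.
rewrite /state_occupancy; under eq_bigr do rewrite occupancy_kernel.
by rewrite -big_distrr /= fdist_sum1 mulr1.
Qed.

Lemma state_occupancy0 pi k s (x0 : S * A) :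
  k = 0%N :> nat -> state_occupancy pi k s = rho s.
Proof.
move=> k0; rewrite state_occupancy_kernel.
under eq_bigr do rewrite state_kernel0 //.
by rewrite -big_distrl /= traj_pr_sum1 ?mul1r.
Qed.

Lemma sum_coord (f : path -> R) (F : S -> A -> R) h :
  \sum_tau f tau * F (tau h).1 (tau h).2 =
  \sum_s \sum_a (\sum_tau f tau * (tau h == (s, a))%:R) * F s a.
Proof.
under [RHS]eq_bigr do under eq_bigr do rewrite big_distrl /=.
under [RHS]eq_bigr do rewrite exchange_big /=.
rewrite [RHS]exchange_big /=; apply: eq_bigr => tau _.
rewrite pair_big /= (bigD1 (tau h)) //= -surjective_pairing eqxx mulr1.
rewrite big1 ?addr0 // => -[s a] /= ne.
by rewrite eq_sym (negbTE ne) mulr0 mul0r.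
Qed.

Lemma state_occupancyS pi h k s : k = h.+1 :> nat ->
  state_occupancy pi k s =
  \sum_s' \sum_a' occupancy rho Q pi h s' a' * Q h s' a' s.
Proof.
move=> kh; rewrite state_occupancy_kernel.
under eq_bigr do rewrite (state_kernelS _ _ kh).
rewrite (sum_coord _ (fun s' a' => Q h s' a' s)).
by under [RHS]eq_bigr do under eq_bigr do rewrite occupancyE.
Qed.

Lemma valueE (w : rewards R S A H) pi :
  value rho Q w pi = \sum_h \sum_s \sum_a w h s a * occupancy rho Q pi h s a.
Proof.
rewrite /value; under eq_bigr do rewrite big_distrr /=.
rewrite exchange_big /=; apply: eq_bigr => h _.
rewrite (sum_coord _ (w h)); apply: eq_bigr => s _; apply: eq_bigr => a _.
by rewrite occupancyE mulrC.
Qed.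

Lemma sum_occupancy pi h (x0 : S * A) :
  \sum_s \sum_a occupancy rho Q pi h s a = 1.
Proof.
rewrite -[RHS](traj_pr_sum1 pi x0).
transitivity (\sum_tau traj_pr rho Q pi tau * 1).
  rewrite (sum_coord _ (fun _ _ => 1) h).
  by apply: eq_bigr => s _; apply: eq_bigr => a _; rewrite mulr1 occupancyE.
by apply: eq_bigr => tau _; rewrite mulr1.
Qed.

(* [P] need only satisfy the flow equations of [Q]: they are linear, hence
   stable under averaging of policies. *)
Lemma occupancy_flow (P : 'I_H -> S -> A -> R) pi (x0 : S * A) :
  (forall h s a, 0 <= P h s a) ->
  (forall k s, k = 0%N :> nat -> \sum_a P k s a = rho s) ->
  (forall h k s, k = h.+1 :> nat ->
     \sum_a P k s a = \sum_s' \sum_a' P h s' a' * Q h s' a' s) ->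
  (forall h s a, \sum_a' P h s a' != 0 ->
     pi h s a = P h s a / \sum_a' P h s a') ->
  forall h s a, occupancy rho Q pi h s a = P h s a.
Proof.
move=> P0 Pinit Pflow Ppi [n nH]; elim: n nH => [|n IHn] nH s a.
  rewrite occupancy_policy state_occupancy0 // -(Pinit (Ordinal nH)) //.
  (* Where the state has no mass [pi] is arbitrary, but nonnegativity forces [P] to vanish there as
     well. *)
  have [z|nz] := eqVneq (\sum_a' P (Ordinal nH) s a') 0.
    rewrite z mul0r; apply/esym/eqP.
    by move/eqP: z; rewrite psumr_eq0 // => /allP /(_ a (mem_index_enum _)).
  by rewrite Ppi // mulrCA mulfV // mulr1.
set k := Ordinal nH; pose h : 'I_H := Ordinal (ltnW nH).
rewrite occupancy_policy (@state_occupancyS pi h) //.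
have -> : \sum_s' \sum_a' occupancy rho Q pi h s' a' * Q h s' a' s =
    \sum_a' P k s a'.
  rewrite (Pflow h) //.
  by apply: eq_bigr => s' _; apply: eq_bigr => a' _; rewrite IHn.
have [z|nz] := eqVneq (\sum_a' P k s a') 0.
  rewrite z mul0r; apply/esym/eqP.
  by move/eqP: z; rewrite psumr_eq0 // => /allP /(_ a (mem_index_enum _)).
by rewrite Ppi // mulrCA mulfV // mulr1.
Qed.

Lemma occupancy_average (T : nat) (pi : nat -> policy R S A H)
    (pibar : policy R S A H) (x0 : S * A) :
  (0 < T)%N ->
  let P h s a := T%:R^-1 * \sum_(t < T) occupancy rho Q (pi t) h s a in
  (forall h s a, \sum_a' P h s a' != 0 ->
     pibar h s a = P h s a / \sum_a' P h s a') ->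
  forall h s a, occupancy rho Q pibar h s a = P h s a.
Proof.
move=> T0 P Ppi.
have sumP h s :
    \sum_a P h s a = T%:R^-1 * \sum_(t < T) state_occupancy (pi t) h s.
  by rewrite -big_distrr /= exchange_big.
apply: occupancy_flow => // [h s a|k s k0|h k s kh].
- by rewrite mulr_ge0 ?invr_ge0 // sumr_ge0 // => t _; apply: occupancy_ge0.
- rewrite sumP; under eq_bigr do rewrite state_occupancy0 //.
  rewrite sumr_const card_ord -[rho s *+ T]mulr_natl mulrA mulVf ?mul1r //.
  by rewrite pnatr_eq0 -lt0n.
- rewrite sumP; under eq_bigr do rewrite (state_occupancyS _ _ kh).
  rewrite exchange_big big_distrr /=; apply: eq_bigr => s' _.
  rewrite exchange_big big_distrr /=; apply: eq_bigr => a' _.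
  by rewrite -big_distrl mulrA.
Qed.

Lemma policy_support pi h s a a' :
  pi h s a' = 1 -> a != a' -> pi h s a = 0.
Proof.
move=> pi1 aa'; have := fdist_sum1 (pi h s); rewrite (bigD1 a') //= pi1.
move/eqP; rewrite -subr_eq0 addrAC subrr add0r psumr_eq0 => [/allP|b _].
  by move/(_ a (mem_index_enum _)); rewrite aa' => /eqP.
exact: fdist_ge0.
Qed.

Lemma traj_pr_action pi tau h a' :
  pi h (tau h).1 a' = 1 -> traj_pr rho Q pi tau != 0 -> (tau h).2 = a'.
Proof.
move=> pi1; apply: contraNeq => ne.
rewrite traj_prE (bigD1 h) //= /step_kernel (policy_support pi1 ne).
by rewrite mulr0 mul0r.
Qed.

(** Both sides reduce to the first [h + 1] factors, which agree on the support of [G]. This serves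
    to exchange a behaviour cloning policy for the expert. *)
Lemma traj_pr_coupling pi pi' h (G : path -> R) (x0 : S * A) :
  depends_below h.+1 G ->
  (forall tau, G tau != 0 -> forall l : 'I_H, (l <= h)%N ->
     forall a, pi l (tau l).1 a = pi' l (tau l).1 a) ->
  \sum_tau traj_pr rho Q pi tau * G tau = \sum_tau traj_pr rho Q pi' tau * G tau.
Proof.
move=> Gh E; under eq_bigr do rewrite (traj_pr_trunc _ x0).
under [RHS]eq_bigr do rewrite (traj_pr_trunc _ x0).
rewrite (@trunc_law_marginal _ _ _ _ (@step_kernel_adapted pi)
  (@step_kernel_sum1 pi) x0 h.+1) //.
rewrite (@trunc_law_marginal _ _ _ _ (@step_kernel_adapted pi')
  (@step_kernel_sum1 pi') x0 h.+1) //.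
apply: eq_bigr => tau _.
have [->|G0] := eqVneq (G tau) 0; first by rewrite !mulr0.
congr (_ * _); apply: eq_bigr => k _; case: ifP => // kh.
by rewrite /step_kernel E.
Qed.

End Occupancy.

(** * Concentration for i.i.d. samples *)

Section Concentration.
Variable R : realType.

Lemma sum_cst (T : finType) (x : R) : \sum_(i : T) x = #|T|%:R * x.
Proof. by rewrite sumr_const -[LHS]mulr_natl. Qed.

(** Squaring [1 - x/2 <= exp (- x/2)] bounds [exp x] by the inverse of [(1 - x/2)^2]. The remaining
    polynomial inequality comes down to [1 - 3 x + x^2 >= 0], the origin of the threshold 1/3. *)
Lemma expR_le_quad (x : R) : x <= 3^-1 -> expR x <= 1 + x + x ^+ 2.
Proof.
move=> x3; have y0 : 0 <= 1 - x / 2 by lra.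
have le1 : (1 - x / 2) ^+ 2 <= expR (- x).
  have -> : - x = - (x / 2) + - (x / 2) by field.
  rewrite expRD -expr2 ler_sqr ?nnegrE ?expR_ge0 //.
  exact: expR_ge1Dx.
have pos : 0 < (1 - x / 2) ^+ 2 by rewrite exprn_gt0 //; lra.
rewrite -(ler_pM2r pos); apply: (@le_trans _ _ 1).
  rewrite -[leRHS](expRxMexpNx_1 x); apply: ler_wpM2l => //; exact: expR_ge0.
have -> : (1 + x + x ^+ 2) * (1 - x / 2) ^+ 2 =
  1 + x ^+ 2 / 4 * (1 - 3 * x + x ^+ 2) by field.
rewrite lerDl mulr_ge0 ?divr_ge0 ?sqr_ge0 //.
by have := sqr_ge0 x; lra.
Qed.

Lemma sum_tuple_prod (T : finType) (n : nat) (F : 'I_n -> T -> R) :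
  \sum_(D : n.-tuple T) \prod_(i < n) F i (tnth D i) =
  \prod_(i < n) \sum_x F i x.
Proof.
rewrite bigA_distr_bigA /=.
pose g (f : {ffun 'I_n -> T}) : n.-tuple T := [tuple f i | i < n].
pose g' (D : n.-tuple T) : {ffun 'I_n -> T} := [ffun i => tnth D i].
rewrite (reindex g) /=; last first.
  exists g' => [f|D] _; first by apply/ffunP => i; rewrite ffunE tnth_mktuple.
  by apply: eq_from_tnth => i; rewrite tnth_mktuple ffunE.
by apply: eq_bigr => f _; apply: eq_bigr => i _; rewrite tnth_mktuple.
Qed.

Definition prob (T : finType) (p : T -> R) (X : pred T) : R :=
  \sum_x p x * (X x)%:R.

Definition iid (T : finType) (p : T -> R) (n : nat) (D : n.-tuple T) : R :=
  \prod_(i < n) p (tnth D i).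

Variables (T : finType) (p : T -> R).
Hypothesis p_ge0 : forall x, 0 <= p x.
Hypothesis p_sum1 : \sum_x p x = 1.

Lemma prob_le1 (X : pred T) : prob p X <= 1.
Proof.
rewrite -p_sum1; apply: ler_sum => x _.
by case: (X x); rewrite ?mulr1 ?mulr0.
Qed.

Lemma iid_ge0 n (D : n.-tuple T) : 0 <= iid p D.
Proof. exact: prodr_ge0. Qed.

Lemma iid_sum1 n : \sum_(D : n.-tuple T) iid p D = 1.
Proof. by rewrite (sum_tuple_prod (fun=> p)) big1. Qed.

Lemma iid_sum_prod n (B : {set 'I_n}) (g : T -> R) :
  \sum_(D : n.-tuple T) iid p D * \prod_(i in B) g (tnth D i) =
  (\sum_x p x * g x) ^+ #|B|.
Proof.
transitivity (\sum_(D : n.-tuple T) \prod_(i < n)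
    (p (tnth D i) * (if i \in B then g (tnth D i) else 1))).
  by apply: eq_bigr => D _; rewrite big_split /= -big_mkcond.
rewrite (sum_tuple_prod (fun i x => p x * (if i \in B then g x else 1))).
rewrite -prodr_const [RHS]big_mkcond /=; apply: eq_bigr => i _.
by case: ifP => // _; under eq_bigr do rewrite mulr1.
Qed.

(** Exponential Markov inequality: one factor of the moment generating function is at most
    [1 + q (theta + theta^2)], hence at most [exp (q (theta + theta^2))]. The sign of [theta] is
    free, so both tails follow. *)
Lemma iid_chernoff n (B : {set 'I_n}) (X : pred T) (theta L : R) :
  theta <= 3^-1 ->
  \sum_(D : n.-tuple T) iid p D *
    (#|B|%:R * prob p X * (theta + theta ^+ 2) + L <=
     theta * \sum_(i in B) (X (tnth D i))%:R)%R%:R <= expR (- L).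
Proof.
move=> th3; set q := prob p X; set c := #|B|%:R * q * (theta + theta ^+ 2).
pose g x := expR (theta * (X x)%:R).
apply: (@le_trans _ _ (\sum_(D : n.-tuple T)
    iid p D * (\prod_(i in B) g (tnth D i)) * expR (- (c + L)))).
  apply: ler_sum => D _; rewrite -mulrA ler_wpM2l ?iid_ge0 //.
  rewrite -expR_sum -big_distrr -expRD /=.
  have [le|_] := boolP (c + L <= _); last exact: expR_ge0.
  by rewrite -[leLHS]expR0 ler_expR subr_ge0.
rewrite -big_distrl /= iid_sum_prod opprD expRD mulrA ger_pMl ?expR_gt0 //.
have mgf : \sum_x p x * g x <= expR (q * (theta + theta ^+ 2)).
  apply: le_trans (expR_ge1Dx _).
  have -> : 1 + q * (theta + theta ^+ 2) =
      \sum_x p x * (1 + (X x)%:R * (theta + theta ^+ 2)).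
    rewrite /q /prob big_distrl -[X in X + _]p_sum1 -big_split /=.
    by apply: eq_bigr => x _; ring.
  apply: ler_sum => x _; rewrite ler_wpM2l // /g; case: (X x) => /=.
    by rewrite mulr1 mul1r addrA expR_le_quad.
  by rewrite mulr0 mul0r expR0 addr0.
have sum0 : 0 <= \sum_x p x * g x.
  by apply: sumr_ge0 => x _; rewrite mulr_ge0 ?expR_ge0.
apply: (@le_trans _ _ (expR (q * (theta + theta ^+ 2)) ^+ #|B| * expR (- c))).
  by rewrite ler_wpM2r ?expR_ge0 // lerXn2r // nnegrE ?expR_ge0.
by rewrite -expRM_natl -expRD /c mulrA subrr expR0.
Qed.

(* A Bernstein bound in which the geometric mean of the variance and deviation
   terms is replaced by their sum weighted by [lam]. *)
Lemma iid_deviation n (B : {set 'I_n}) (X : pred T) (lam L : R) :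
  0 < lam -> lam <= 3^-1 ->
  \sum_(D : n.-tuple T) iid p D *
    (~~ (`|\sum_(i in B) (X (tnth D i))%:R - #|B|%:R * prob p X| <=
      lam * (#|B|%:R * prob p X) + L / lam))%:R <= expR (- L) *+ 2.
Proof.
move=> lam0 lam3; have := iid_chernoff B X L lam3.
have Nlam3 : - lam <= 3^-1 by lra.
have := iid_chernoff B X L Nlam3.
move=> low up; rewrite mulr2n; apply: le_trans (lerD up low).
rewrite -big_split /=; apply: ler_sum => D _.
rewrite -mulrDr ler_wpM2l ?iid_ge0 //.
set Y := \sum_(i in B) _; set c := #|B|%:R * prob p X.
have [_|] := boolP (`|Y - c| <= _); first by rewrite addr_ge0.
have LE : lam * (L / lam) = L by rewrite mulrCA mulfV ?mulr1 ?gt_eqF.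
rewrite -ltNge ltr_normr; case/orP => [lt|lt].
- suff -> : c * (lam + lam ^+ 2) + L <= lam * Y by rewrite lerDl.
  by move: lt; rewrite -(ltr_pM2l lam0) mulrDr LE mulrBr => lt; nra.
- suff -> : c * (- lam + (- lam) ^+ 2) + L <= - lam * Y by rewrite lerDr.
  by move: lt; rewrite -(ltr_pM2l lam0) mulrDr LE mulrN mulrBr => lt; nra.
Qed.

Lemma iid_miss n (B : {set 'I_n}) (X : pred T) :
  \sum_(D : n.-tuple T) iid p D * [forall i in B, ~~ X (tnth D i)]%:R <=
  expR (- (prob p X * #|B|%:R)).
Proof.
have -> : \sum_(D : n.-tuple T) iid p D * [forall i in B, ~~ X (tnth D i)]%:R =
    (1 - prob p X) ^+ #|B|.
  have -> : 1 - prob p X = \sum_x p x * (~~ X x)%:R.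
    rewrite /prob -[X in X - _]p_sum1 -sumrB; apply: eq_bigr => x _.
    by case: (X x); rewrite ?mulr1 ?mulr0 ?subrr ?subr0.
  rewrite -(iid_sum_prod B (fun x => (~~ X x)%:R)); apply: eq_bigr => D _.
  congr (_ * _); case: (boolP [forall i in B, _]) => [/forall_inP all0|].
    by rewrite big1 // => i /all0 ->.
  rewrite negb_forall_in => /exists_inP[i iB /negbTE Xi].
  by rewrite (bigD1 i) //= Xi mul0r.
rewrite -mulNr expRM_natr lerXn2r ?nnegrE ?expR_ge0 ?subr_ge0 ?prob_le1 //.
exact: expR_ge1Dx.
Qed.

(* Resampling the trajectories outside [B] makes them independent of D1, so that
   the random events defined by D1 can be treated as fixed. *)
Lemma iid_resample n (B : {set 'I_n}) (Phi : n.-tuple T -> R) :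
  \sum_(D : n.-tuple T) iid p D * Phi D =
  \sum_(D : n.-tuple T) iid p D * \sum_(D' : n.-tuple T) iid p D' *
    Phi [tuple if i \in B then tnth D i else tnth D' i | i < n].
Proof.
under [RHS]eq_bigr do rewrite big_distrr /=.
rewrite pair_big /=.
pose merge (D D' : n.-tuple T) :=
  [tuple if i \in B then tnth D i else tnth D' i | i < n].
(* Exchanging the entries outside [B] between the two samples is an involution that preserves the
   product law. *)
pose swap (u : n.-tuple T * n.-tuple T) := (merge u.1 u.2, merge u.2 u.1).
have mergeK D D' : merge (merge D D') (merge D' D) = D.
  by apply: eq_from_tnth => i; rewrite !tnth_mktuple; case: (i \in B).
have swapK : involutive swap by case=> D D'; rewrite /swap /= !mergeK.
rewrite [RHS](eq_bigr (fun u : n.-tuple T * n.-tuple T =>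
  iid p u.1 * (iid p u.2 * Phi (merge u.1 u.2)))) //.
rewrite [RHS](reindex_inj (inv_inj swapK)) /=.
have iidM D D' : iid p (merge D D') * iid p (merge D' D) = iid p D * iid p D'.
  rewrite /iid -!big_split /=; apply: eq_bigr => i _; rewrite !tnth_mktuple.
  by case: (i \in B) => //; rewrite mulrC.
under [RHS]eq_bigr do rewrite mergeK mulrA iidM.
rewrite -(pair_big xpredT xpredT (fun D D' => iid p D * iid p D' * Phi D)) /=.
apply: eq_bigr => D _; rewrite -big_distrl -big_distrr /= iid_sum1.
by rewrite mulr1.
Qed.
End Concentration.

(** * The estimator of the expert occupancy *)

Section ImitationError.
Variables (R : realType) (S A : finType) (H : nat).
Local Notation path := (traj S A H).
Variables (rho : fdist R S) (Q : transitions R S A H) (piE : 'I_H -> S -> A).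
Variables (D1 : seq path) (pi : policy R S A H).
Hypothesis pi_bc : in_PiBC piE D1 pi.
Implicit Types (tau : path) (h l : 'I_H) (s : S) (a : A).

Local Notation pE := (traj_pr rho Q (det_policy R piE)).
Local Notation pB := (traj_pr rho Q pi).

Definition at_state h s : pred path := fun tau => (tau h).1 == s.
Definition at_state_in h s : pred path :=
  fun tau => ((tau h).1 == s) && in_Tr D1 h tau.
Definition at_state_out h s : pred path :=
  fun tau => ((tau h).1 == s) && ~~ in_Tr D1 h tau.

Lemma sum_at_state (f : path -> bool) (p : path -> R) h :
  \sum_s prob p (fun tau => ((tau h).1 == s) && f tau) = prob p f.
Proof.
rewrite /prob exchange_big /=; apply: eq_bigr => tau _.
rewrite -big_distrr (bigD1 (tau h).1) //= eqxx big1 ?addr0 // => s.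
by rewrite eq_sym => /negbTE ->.
Qed.

Lemma det_occupancy h s a :
  occupancy rho Q (det_policy R piE) h s a =
  (a == piE h s)%:R * prob pE (at_state h s).
Proof.
rewrite occupancy_policy mulrC; congr (_ * _).
rewrite /state_occupancy; under eq_bigr do rewrite occupancyE.
rewrite exchange_big /=; apply: eq_bigr => tau _.
rewrite -big_distrr (bigD1 (tau h).2) //= big1 => [|a'].
  by rewrite addr0 {1}[tau h]surjective_pairing xpair_eqE eqxx andbT.
rewrite {2}[tau h]surjective_pairing xpair_eqE andbC eq_sym.
by move=> /negbTE ->.
Qed.

Lemma visited_path h tau l :
  in_Tr D1 h tau -> (l <= h)%N -> (tau l).1 \in visited D1 l.
Proof. by move=> /forallP/(_ l)/implyP; apply. Qed.

(** Inside [in_Tr] all states up to step [h] occur in [D1], and there both policies play the expert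
    action with probability one. *)
Lemma visit_split h s :
  prob pE (at_state h s) =
  prob pB (at_state_in h s) + prob pE (at_state_out h s).
Proof.
have -> : prob pB (at_state_in h s) = prob pE (at_state_in h s).
  apply: (@traj_pr_coupling _ _ _ _ _ _ _ _ h) => [|tau tau' E|tau].
  - exact: (s, piE h s).
  - congr (nat_of_bool _)%:R; rewrite /at_state_in E //; congr (_ && _).
    by apply: eq_forallb => l; case: (leqP l h) => //= lh; rewrite E.
  rewrite /at_state_in; case: (boolP (in_Tr _ _ _)) => [inT _ l lh a|].
    have vis := visited_path inT lh.
    have [->|ne] := eqVneq a (piE l (tau l).1); first by rewrite pi_bc //= eqxx.
    by rewrite (policy_support (pi_bc vis) ne) /= (negbTE ne).
  by rewrite andbF eqxx.
rewrite /prob -big_split /=; apply: eq_bigr => tau _; rewrite -mulrDr.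
rewrite /at_state /at_state_in /at_state_out.
by case: (_ == s); case: (in_Tr _ _ _); rewrite /= ?addr0 ?add0r.
Qed.

(** A path outside [in_Tr] meets an unvisited state at some step [l <= h]; the union over steps and
    unvisited states costs at most the factor [H * #|S|]. *)
Lemma out_mass h (t : R) :
  0 <= t -> (forall l s, s \notin visited D1 l -> prob pE (at_state l s) <= t) ->
  \sum_s prob pE (at_state_out h s) <= H%:R * (#|S|%:R * t).
Proof.
move=> t0 miss; rewrite sum_at_state.
apply: (@le_trans _ _
    (\sum_l \sum_(s | s \notin visited D1 l) prob pE (at_state l s))).
  rewrite /prob; under [leRHS]eq_bigr do rewrite exchange_big /=.
  rewrite [leRHS]exchange_big /=; apply: ler_sum => tau _.
  under [leRHS]eq_bigr do rewrite -big_distrr /=.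
  rewrite -big_distrr ler_wpM2l ?traj_pr_ge0 //=.
  case: (boolP (in_Tr D1 h tau)) => [_|] /=.
    by do 2 apply: sumr_ge0 => ? _.
  rewrite negb_forall => /existsP[l]; rewrite negb_imply => /andP[_ out].
  rewrite (bigD1 l) //= (bigD1 (tau l).1) //= /at_state eqxx -addrA lerDl.
  by rewrite addr_ge0 ?sumr_ge0 // => l' _; rewrite sumr_ge0.
apply: (@le_trans _ _ (\sum_(l < H) #|S|%:R * t)); last first.
  by rewrite sumr_const card_ord -[leLHS]mulr_natl.
apply: ler_sum => l _.
apply: (@le_trans _ _ (\sum_(s | s \notin visited D1 l) t)).
  by apply: ler_sum => s; apply: miss.
by rewrite sumr_const -[leLHS]mulr_natl ler_wpM2r // ler_nat max_card.
Qed.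

Variables (D1c Denv : seq path).
Hypothesis D1c_expert : forall tau, tau \in D1c ->
  forall h, (tau h).2 = piE h (tau h).1.
Hypothesis Denv_expert : forall tau, tau \in Denv ->
  forall h, in_Tr D1 h tau -> (tau h).2 = piE h (tau h).1.

(** Expert trajectories, and rollouts as long as they stay in [in_Tr], show only expert actions.
    Deviations therefore need control per state and not per state-action pair. *)
Lemma Ptilde_expert h s a :
  Ptilde R D1 D1c Denv h s a = (a == piE h s)%:R *
    ((count (at_state_in h s) Denv)%:R / (size Denv)%:R +
     (count (at_state_out h s) D1c)%:R / (size D1c)%:R).
Proof.
rewrite /Ptilde; have [->|ne] := eqVneq a (piE h s).
  rewrite mul1r; congr (_%:R / _ + _%:R / _).
    apply: eq_in_count => tau tauD; rewrite /at_state_in.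
    case: (boolP (in_Tr D1 h tau)) => [inT|_]; rewrite ?andbF // !andbT.
    rewrite [tau h]surjective_pairing (Denv_expert tauD) //= xpair_eqE.
    by case: eqP => //= ->; rewrite eqxx.
  apply: eq_in_count => tau tauD; rewrite /at_state_out.
  rewrite {1}[tau h]surjective_pairing (D1c_expert tauD) //= xpair_eqE.
  by case: eqP => //= ->; rewrite eqxx.
rewrite mul0r (eq_in_count (a2 := pred0)) => [|tau tauD]; last first.
  case: (boolP (in_Tr D1 h tau)) => [inT|_]; rewrite ?andbF // !andbT.
  rewrite [tau h]surjective_pairing (Denv_expert tauD) //= xpair_eqE.
  by case: eqP => //= ->; rewrite eq_sym (negbTE ne).
rewrite count_pred0 mul0r add0r (eq_in_count (a2 := pred0)) => [|tau tauD].
  by rewrite count_pred0 mul0r.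
rewrite {1}[tau h]surjective_pairing (D1c_expert tauD) //= xpair_eqE.
by case: eqP => //= ->; rewrite eq_sym (negbTE ne).
Qed.

(** The deviations are linear in the probabilities. Summed over states, the first terms cost at most
    [lam1] since the total mass is at most 1, and the second ones [lam2] times the mass off [in_Tr],
    bounded by [out_mass]. *)
Lemma estimation_error (x0 : S * A) (lam1 lam2 L t : R) (n1 n2 : nat) :
  (0 < n1)%N -> (0 < n2)%N -> size Denv = n1 -> size D1c = n2 ->
  0 <= lam1 -> 0 <= lam2 -> 0 <= t ->
  (forall l s, s \notin visited D1 l -> prob pE (at_state l s) <= t) ->
  (forall h s, `|(count (at_state_in h s) Denv)%:R -
       n1%:R * prob pB (at_state_in h s)| <=
     lam1 * (n1%:R * prob pB (at_state_in h s)) + L / lam1) ->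
  (forall h s, `|(count (at_state_out h s) D1c)%:R -
       n2%:R * prob pE (at_state_out h s)| <=
     lam2 * (n2%:R * prob pE (at_state_out h s)) + L / lam2) ->
  \sum_h \sum_s \sum_a `|Ptilde R D1 D1c Denv h s a -
     occupancy rho Q (det_policy R piE) h s a| <=
  H%:R * (lam1 + lam2 * (H%:R * (#|S|%:R * t)) +
    #|S|%:R * (L / lam1 / n1%:R + L / lam2 / n2%:R)).
Proof.
move=> n1_gt0 n2_gt0 sz1 sz2 lam1_ge0 lam2_ge0 t0 miss dev1 dev2.
have rescale (n : nat) (lam x q : R) : (0 < n)%N ->
    `|x - n%:R * q| <= lam * (n%:R * q) + L / lam ->
    `|x / n%:R - q| <= lam * q + L / lam / n%:R.
  move=> n_gt0 le; have nR : 0 < n%:R :> R by rewrite ltr0n.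
  rewrite -(ler_pM2r nR) mulrDl -!mulrA mulVf ?gt_eqF // mulr1.
  rewrite -[X in _ * X <= _](gtr0_norm nR) -normrM mulrBl divfK ?gt_eqF //.
  by rewrite [q * _]mulrC.
apply: (@le_trans _ _ (\sum_(h < H) (lam1 + lam2 * (H%:R * (#|S|%:R * t)) +
    #|S|%:R * (L / lam1 / n1%:R + L / lam2 / n2%:R)))); last first.
  by rewrite sumr_const card_ord -[leLHS]mulr_natl.
apply: ler_sum => h _.
apply: (@le_trans _ _ (\sum_s
    ((lam1 * prob pB (at_state_in h s) + L / lam1 / n1%:R) +
     (lam2 * prob pE (at_state_out h s) + L / lam2 / n2%:R)))).
  apply: ler_sum => s _.
  rewrite (bigD1 (piE h s)) //= [X in _ + X]big1 ?addr0 => [|a /negbTE ne].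
    rewrite Ptilde_expert det_occupancy eqxx !mul1r visit_split sz1 sz2.
    rewrite opprD addrACA; apply: le_trans (ler_normD _ _) _.
    by apply: lerD; apply: rescale.
  by rewrite Ptilde_expert det_occupancy ne !mul0r subrr normr0.
rewrite !big_split /= !sum_cst -!big_distrr /= addrACA mulrDr lerD2r.
apply: lerD.
  rewrite ler_piMr // sum_at_state; apply: prob_le1 => [tau|].
    exact: traj_pr_ge0.
  exact: traj_pr_sum1.
by rewrite ler_wpM2l // out_mass.
Qed.
End ImitationError.

(** * Gradient descent on the box of weights *)

Section GradientDescent.
Variables (R : realType) (I : finType).
Implicit Types (x p u : I -> R).

(** Testing minimality at [p + th * (u - p)] gives the obtuse angle criterion [d <= 0]; expanding
    the square at [th = 1] turns it into the claim. *)
Lemma box_projection_nonexpansive x p u :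
  (forall i, `|p i| <= 1) -> (forall i, `|u i| <= 1) ->
  (forall v : I -> R, (forall i, `|v i| <= 1) ->
     \sum_i (x i - p i) ^+ 2 <= \sum_i (x i - v i) ^+ 2) ->
  \sum_i (p i - u i) ^+ 2 <= \sum_i (x i - u i) ^+ 2.
Proof.
move=> pW uW pmin; set d := \sum_i (x i - p i) * (u i - p i).
set e := \sum_i (p i - u i) ^+ 2.
have expand th : \sum_i (x i - (p i + th * (u i - p i))) ^+ 2 =
    \sum_i (x i - p i) ^+ 2 - 2 * th * d + th ^+ 2 * e.
  rewrite /d /e !big_distrr -sumrB -big_split /=.
  by apply: eq_bigr => i _; ring.
have obtuse th : 0 <= th <= 1 -> 2 * th * d <= th ^+ 2 * e.
  move=> /andP[th0 th1].
  have := pmin (fun i => p i + th * (u i - p i)); rewrite expand => H.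
  suff : \sum_i (x i - p i) ^+ 2 <=
      \sum_i (x i - p i) ^+ 2 - 2 * th * d + th ^+ 2 * e by lra.
  apply: H => i; have := pW i; have := uW i; rewrite !ler_norml.
  by move=> /andP[? ?] /andP[? ?]; apply/andP; split; nra.
(* If [d > 0], then [th = 1] gives [2 d <= e], so [d / e] is an admissible [th]. It minimises the
   quadratic and contradicts the minimality of [p]. *)
have d0 : d <= 0.
  rewrite leNgt; apply/negP => d0.
  have := obtuse 1; rewrite ler01 lexx => /(_ isT).
  rewrite mulr1 expr1n mul1r => de; have e0 : 0 < e by lra.
  have de1 : 0 <= d / e <= 1.
    by rewrite (ltW (divr_gt0 d0 e0)) ler_pdivrMr // mul1r; lra.
  have := obtuse _ de1; have -> : 2 * (d / e) * d = 2 * (d ^+ 2 / e) by ring.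
  have -> : (d / e) ^+ 2 * e = d ^+ 2 / e by field; rewrite gt_eqF.
  have : 0 < d ^+ 2 / e by rewrite divr_gt0 ?exprn_gt0.
  lra.
have := expand 1; rewrite (eq_bigr (fun i => (x i - u i) ^+ 2)) => [->|i _].
  have : 0 <= \sum_i (x i - p i) ^+ 2 by apply: sumr_ge0 => i _; apply: sqr_ge0.
  by rewrite expr1n mul1r; lra.
by congr (_ ^+ 2); ring.
Qed.

(** The squared distance to [u] is the potential; keeping its final value on the left makes the
    induction go through. *)
Lemma gradient_descent_regret (T : nat) (w g : nat -> I -> R) u (eta G : R) :
  (forall t, (t < T)%N ->
     \sum_i (w t.+1 i - u i) ^+ 2 <= \sum_i (w t i - eta * g t i - u i) ^+ 2) ->
  (forall t, (t < T)%N -> \sum_i g t i ^+ 2 <= G) ->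
  2 * eta * (\sum_(t < T) \sum_i g t i * (w t i - u i)) <=
  \sum_i (w 0%N i - u i) ^+ 2 + T%:R * (eta ^+ 2 * G).
Proof.
move=> step gG.
suff : 2 * eta * (\sum_(t < T) \sum_i g t i * (w t i - u i)) +
    \sum_i (w T i - u i) ^+ 2 <=
  \sum_i (w 0%N i - u i) ^+ 2 + T%:R * (eta ^+ 2 * G).
  have : 0 <= \sum_i (w T i - u i) ^+ 2.
    by apply: sumr_ge0 => i _; apply: sqr_ge0.
  lra.
elim: T step gG => [|T IHT] step gG.
  by rewrite big_ord0 mulr0 mul0r add0r addr0.
have := IHT (fun t tT => step t (ltnW tT)) (fun t tT => gG t (ltnW tT)).
have := step T (ltnSn T); have := gG T (ltnSn T).
rewrite big_ord_recr /= mulrDr -natr1 mulrDl mul1r.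
have -> : \sum_i (w T i - eta * g T i - u i) ^+ 2 =
    \sum_i (w T i - u i) ^+ 2 - 2 * eta * (\sum_i g T i * (w T i - u i)) +
    eta ^+ 2 * (\sum_i g T i ^+ 2).
  rewrite !big_distrr -sumrB -big_split /=.
  by apply: eq_bigr => i _; ring.
move=> /(ler_wpM2l (sqr_ge0 eta)); lra.
Qed.

End GradientDescent.

(** * Regret and output of TAIL in a fixed model *)

Section Tail.
Variables (R : realType) (S A : finType) (H : nat).
Variables (rho : fdist R S) (Q : transitions R S A H).
Variables (Pt : 'I_H -> S -> A -> R).

Lemma sum3E (F : 'I_H -> S -> A -> R) :
  \sum_h \sum_s \sum_a F h s a = \sum_(i : 'I_H * S * A) F i.1.1 i.1.2 i.2.
Proof. by rewrite !pair_big. Qed.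

Lemma sum3B (F G : 'I_H -> S -> A -> R) :
  \sum_h \sum_s \sum_a (F h s a - G h s a) =
  \sum_h \sum_s \sum_a F h s a - \sum_h \sum_s \sum_a G h s a.
Proof. by rewrite !sum3E sumrB. Qed.

Lemma gradient_linear (g w : rewards R S A H) h s a :
  gradient (fun v : rewards R S A H =>
    \sum_h \sum_s \sum_a v h s a * g h s a) w h s a = g h s a.
Proof.
rewrite /gradient; set f := (fun x : R => _).
have -> : f = (fun x => (\sum_h \sum_s \sum_a w h s a * g h s a) + x * g h s a).
  apply/funext => x; rewrite /f !sum3E (bigD1 (h, s, a)) //= eqxx.
  rewrite [in RHS](bigD1 (h, s, a)) //= mulrDl addrAC; congr (_ + _ + _).
  by apply: eq_bigr => -[[h' s'] a'] /= /negbTE ->; rewrite addr0.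
rewrite derive1E deriveD // derive_cst add0r.
by rewrite -derive1E derive1Mr // derive1_id mul1r.
Qed.

(** For [o] in [0, 1] and [y] in [0, 2] one has [(o - y)^2 <= o + 2 y], which sums to [1 + 4] per
    step. The estimator is only known to have mass at most 2, as it adds frequencies from two data
    sets. *)
Lemma sum_sqr_gradient pi (x0 : S * A) :
  (forall h s a, 0 <= Pt h s a) ->
  (forall h, \sum_s \sum_a Pt h s a <= 2) ->
  \sum_h \sum_s \sum_a (occupancy rho Q pi h s a - Pt h s a) ^+ 2 <= 5 * H%:R.
Proof.
move=> Pt0 Pt2; have le_sum (F : S -> A -> R) s a :
    (forall s a, 0 <= F s a) -> F s a <= \sum_s \sum_a F s a.
  move=> F0; rewrite (bigD1 s) //= (bigD1 a) //= -addrA lerDl.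
  by rewrite addr_ge0 ?sumr_ge0 // => s' _; rewrite sumr_ge0.
apply: (@le_trans _ _ (\sum_(h < H) 5)); last first.
  by rewrite sumr_const card_ord mulr_natr.
apply: ler_sum => h _; apply: (@le_trans _ _
    (\sum_s \sum_a (occupancy rho Q pi h s a + 2 * Pt h s a))).
  apply: ler_sum => s _; apply: ler_sum => a _.
  have o0 := @occupancy_ge0 _ _ _ _ rho Q pi h s a.
  have := le_sum _ s a (@occupancy_ge0 _ _ _ _ rho Q pi h).
  rewrite (sum_occupancy _ _ _ _ x0).
  have := le_trans (le_sum _ s a (Pt0 h)) (Pt2 h); have := Pt0 h s a.
  by move: (Pt h s a) (occupancy _ _ _ _ _ _) o0 => y o *; nra.
rewrite (eq_bigr (fun s => \sum_a occupancy rho Q pi h s a +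
  2 * \sum_a Pt h s a)) => [|s _]; last by rewrite big_split -big_distrr.
rewrite big_split -big_distrr /= (sum_occupancy _ _ _ _ x0).
by have := Pt2 h; lra.
Qed.

Lemma proj_W_nonexpansive (x p u : rewards R S A H) :
  is_proj_W x p -> in_W u ->
  \sum_h \sum_s \sum_a (p h s a - u h s a) ^+ 2 <=
  \sum_h \sum_s \sum_a (x h s a - u h s a) ^+ 2.
Proof.
move=> [pW pmin] uW; rewrite !sum3E.
apply: (box_projection_nonexpansive
  (x := fun i : 'I_H * S * A => x i.1.1 i.1.2 i.2)) => // v vW.
have := pmin (fun h s a => v (h, s, a)) (fun h s a => vW (h, s, a)).
rewrite /Defs.edist !sum3E ler_psqrt ?nnegrE ?sumr_ge0 // => [le|i _|i _];
  rewrite ?sqr_ge0 //.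
by apply: le_trans le _; apply: ler_sum => -[[h s] a].
Qed.

(** Gradient descent with comparator [r] bounds the sum of the products [g t . (w t - r)] from
    above, while near-optimality of [pi t] against the expert bounds each [g t . w t] below by
    [- (beta + eps_opt)]. The difference of the averages is the average of [- g t . r], which is the
    left side because [pibar] has the averaged occupancy. *)
Lemma TAIL_guarantee (eps_opt e beta : R) (T : nat) (r : rewards R S A H)
    (piE pibar : policy R S A H) (eta : nat -> R) (x0 : S * A) :
  (0 < T)%N -> 0 < e -> (forall t, eta t = e) -> in_W r ->
  (forall h s a, 0 <= Pt h s a) ->
  (forall h, \sum_s \sum_a Pt h s a <= 2) ->
  (forall w, in_W w ->
     \sum_h \sum_s \sum_a w h s a * (Pt h s a - occupancy rho Q piE h s a)
       <= beta) ->
  TAIL_output rho Q Pt eps_opt T eta pibar ->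
  \sum_h \sum_s \sum_a r h s a * (Pt h s a - occupancy rho Q pibar h s a) <=
  beta + eps_opt +
  (2 * (H%:R * #|S|%:R * #|A|%:R) / (e * T%:R) + 5 / 2 * H%:R * e).
Proof.
move=> T0 e0 etaE rW Pt0 Pt2 Hbeta [w [pi [w0W opt step out]]].
have TR : 0 < T%:R :> R by rewrite ltr0n.
pose g t h s a := occupancy rho Q (pi t) h s a - Pt h s a.
have wW t : (t <= T)%N -> in_W (w t).
  by case: t => // t tT; case: (step t tT).
have regret := @gradient_descent_regret R ('I_H * S * A)%type T
  (fun t i => w t i.1.1 i.1.2 i.2) (fun t i => g t i.1.1 i.1.2 i.2)
  (fun i => r i.1.1 i.1.2 i.2) e (5 * H%:R).
have {}regret := regret _ _.
have {regret} : 2 * e * (\sum_(t < T) \sum_h \sum_s \sum_a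
    g t h s a * (w t h s a - r h s a)) <=
  \sum_h \sum_s \sum_a (w 0%N h s a - r h s a) ^+ 2 +
    T%:R * (e ^+ 2 * (5 * H%:R)).
  rewrite sum3E; under eq_bigr do rewrite sum3E.
  apply: regret => t tT; last first.
    rewrite -(sum3E (fun h s a => g t h s a ^+ 2)).
    exact: sum_sqr_gradient.
  have := proj_W_nonexpansive (step t tT) rW.
  rewrite !sum3E etaE.
  by under [leRHS]eq_bigr do rewrite gradient_linear.
have : \sum_h \sum_s \sum_a (w 0%N h s a - r h s a) ^+ 2 <=
    4 * (H%:R * #|S|%:R * #|A|%:R).
  apply: (@le_trans _ _ (\sum_(h < H) \sum_(s : S) \sum_(a : A) 4)).
    apply: ler_sum => h _; apply: ler_sum => s _; apply: ler_sum => a _.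
    have := w0W h s a; have := rW h s a; rewrite !ler_norml.
    by move=> /andP[? ?] /andP[? ?]; nra.
  by rewrite !sum_cst card_ord; lra.
have lower t : (t < T)%N ->
    - (beta + eps_opt) <= \sum_h \sum_s \sum_a g t h s a * w t h s a.
  move=> tT; have := opt t tT piE; have := Hbeta _ (wW t (ltnW tT)).
  have flat (P' : policy R S A H) : \sum_h \sum_s \sum_a
      w t h s a * (Pt h s a - occupancy rho Q P' h s a) =
      \sum_h \sum_s \sum_a w t h s a * Pt h s a - value rho Q (w t) P'.
    rewrite valueE -sum3B !sum3E.
    by apply: eq_bigr => i _; rewrite mulrBr.
  have -> : \sum_h \sum_s \sum_a g t h s a * w t h s a = - \sum_h \sum_s \sum_a
      w t h s a * (Pt h s a - occupancy rho Q (pi t) h s a).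
    rewrite !sum3E -sumrN; apply: eq_bigr => i _; rewrite /g; ring.
  rewrite !flat; lra.
have gain : \sum_h \sum_s \sum_a
    r h s a * (Pt h s a - occupancy rho Q pibar h s a) =
  T%:R^-1 * (\sum_(t < T) (\sum_h \sum_s \sum_a g t h s a * (w t h s a - r h s a)
    - \sum_h \sum_s \sum_a g t h s a * w t h s a)).
  rewrite sum3E; under [in RHS]eq_bigr do rewrite -sum3B sum3E.
  rewrite exchange_big big_distrr /=; apply: eq_bigr => -[[h s] a] _ /=.
  rewrite (occupancy_average x0 T0 out).
  rewrite [in RHS](eq_bigr (fun t : 'I_T => r h s a * Pt h s a -
    r h s a * occupancy rho Q (pi t) h s a)) => [|t _]; last by rewrite /g; ring.
  rewrite sumrB sum_cst card_ord -big_distrr /=; field.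
  by rewrite gt_eqF.
rewrite gain sumrB ler_pdivrMl //.
have : T%:R * - (beta + eps_opt) <=
    \sum_(t < T) \sum_h \sum_s \sum_a g t h s a * w t h s a.
  rewrite -[X in X%:R](card_ord T) -sum_cst.
  by apply: ler_sum => t _; apply: lower.
set U := (X in _ <= X) => lowerU.
set D0 := \sum_h _; set c := H%:R * _ * _ => D0c.
set Z := (X in 2 * e * X) => regret.
have : Z <= 2 * c / e + 5 / 2 * H%:R * e * T%:R.
  have e2 : 0 < 2 * e by lra.
  rewrite -(ler_pM2l e2).
  have -> : 2 * e * (2 * c / e + 5 / 2 * H%:R * e * T%:R) =
      4 * c + T%:R * (e ^+ 2 * (5 * H%:R)) by field; rewrite gt_eqF.
  lra.
have -> : T%:R * (beta + eps_opt + (2 * c / (e * T%:R) + 5 / 2 * H%:R * e)) =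
    T%:R * (beta + eps_opt) + (2 * c / e + 5 / 2 * H%:R * e * T%:R).
  by field; rewrite !gt_eqF.
rewrite -/Z -/U; lra.
Qed.

End Tail.

(** * Union bound over the data *)

Section Estimator.
Variables (R : realType) (S A : finType) (H : nat).
Local Notation path := (traj S A H).

Lemma Ptilde_ge0 (D1 D1c Denv : seq path) h s a :
  0 <= Ptilde R D1 D1c Denv h s a.
Proof. by rewrite /Ptilde addr_ge0 ?divr_ge0. Qed.

Lemma sum_count_le1 (h : 'I_H) (f : pred path) (D : seq path) :
  \sum_s \sum_a (count (fun tau : path => (tau h == (s, a)) && f tau) D)%:R /
    (size D)%:R <= 1 :> R.
Proof.
under eq_bigr do rewrite -big_distrl /=; rewrite -big_distrl /=.
(* An empty data set gives 0, since the inverse of 0 is 0. *)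
have [->|D0] := posnP (size D); first by rewrite invr0 mulr0.
rewrite ler_pdivrMr ?ltr0n // mul1r pair_big /= -natr_sum ler_nat.
rewrite (eq_bigr (fun x : S * A =>
  \sum_(tau <- D) ((tau h == x) && f tau))%N) => [|[s a] _]; last first.
  by rewrite -sum1_count big_mkcond; apply: eq_bigr => tau _ /=; case: ifP.
rewrite exchange_big /= -sum1_size; apply: leq_sum => tau _.
rewrite (bigD1 (tau h)) //= big1 ?addn0 ?leq_b1 // => x.
by rewrite eq_sym => /negbTE ->.
Qed.

Lemma Ptilde_mass (D1 D1c Denv : seq path) h :
  \sum_s \sum_a Ptilde R D1 D1c Denv h s a <= 2.
Proof.
rewrite /Ptilde; under eq_bigr do rewrite big_split /=; rewrite big_split /=.
have := sum_count_le1 h (in_Tr D1 h) Denv.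
have := sum_count_le1 h (fun tau => ~~ in_Tr D1 h tau) D1c.
lra.
Qed.

(** [alpha] is paid once for the weights of TAIL, through [beta], and once for the reward [r];
    [kappa] is paid to move [piE] into the model [Q] and to move [pibar] back to [P]. *)
Lemma imitation_gap (rho : fdist R S) (P Q : transitions R S A H)
    (Pt : 'I_H -> S -> A -> R) (alpha kappa e eps_opt : R) (T : nat)
    (r : rewards R S A H) (piE pibar : policy R S A H) (eta : nat -> R)
    (x0 : S * A) :
  (0 < T)%N -> 0 < e -> (forall t, eta t = e) -> in_W r ->
  (forall h s a, 0 <= Pt h s a) ->
  (forall h, \sum_s \sum_a Pt h s a <= 2) ->
  (forall pi w, in_W w -> `|value rho P w pi - value rho Q w pi| <= kappa) ->
  \sum_h \sum_s \sum_a `|Pt h s a - occupancy rho P piE h s a| <= alpha ->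
  TAIL_output rho Q Pt eps_opt T eta pibar ->
  value rho P r piE - value rho P r pibar <= 2 * alpha + 2 * kappa + eps_opt +
   (2 * (H%:R * #|S|%:R * #|A|%:R) / (e * T%:R) + 5 / 2 * H%:R * e).
Proof.
move=> T0 e0 etaE rW Pt0 Pt2 PQ err out.
have flat (w : rewards R S A H) Q' (pi : policy R S A H) : \sum_h \sum_s \sum_a
    w h s a * (Pt h s a - occupancy rho Q' pi h s a) =
    \sum_h \sum_s \sum_a w h s a * Pt h s a - value rho Q' w pi.
  rewrite valueE -sum3B !sum3E.
  by apply: eq_bigr => i _; rewrite mulrBr.
have errW (w : rewards R S A H) : in_W w ->
    `|\sum_h \sum_s \sum_a w h s a * Pt h s a - value rho P w piE| <= alpha.
  move=> wW; rewrite -flat; apply: le_trans err; rewrite !sum3E.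
  apply: le_trans (ler_norm_sum _ _ _) _; apply: ler_sum => i _.
  by rewrite normrM ler_piMl.
have betaH (w : rewards R S A H) : in_W w -> \sum_h \sum_s \sum_a
    w h s a * (Pt h s a - occupancy rho Q piE h s a) <= alpha + kappa.
  move=> wW; rewrite flat; have := errW w wW; have := PQ piE w wW.
  by rewrite !ler_norml => /andP[? ?] /andP[? ?]; lra.
have := TAIL_guarantee x0 T0 e0 etaE rW Pt0 Pt2 betaH out; rewrite flat.
have := errW r rW; have := PQ pibar r rW.
by rewrite !ler_norml => /andP[? ?] /andP[? ?]; lra.
Qed.

End Estimator.

(** * Probability that the data are good, for a fixed split *)

Section Sampling.
Variables (R : realType) (S A : finType) (H : nat).
Local Notation path := (traj S A H).

Lemma union_bound (T I : finType) (p : T -> R) (X : I -> T -> R) (c : R) :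
  \sum_x p x = 1 -> (forall i, \sum_x p x * X i x <= c) ->
  1 - #|I|%:R * c <= \sum_x p x * (1 - \sum_i X i x).
Proof.
move=> p1 Xc; under eq_bigr do rewrite mulrBr mulr1 big_distrr /=.
rewrite sumrB p1 exchange_big /= lerB // -sum_cst.
exact: ler_sum.
Qed.

Lemma sum_prod_pred_le (I : finType) (a : pred I) :
  1 - \sum_i (~~ a i)%:R <= [forall i, a i]%:R :> R.
Proof.
have s0 (P : pred I) : 0 <= \sum_(i | P i) (~~ a i)%:R :> R by apply: sumr_ge0.
case: (boolP [forall i, a i]) => [_|]; first by rewrite gerBl.
rewrite negb_forall => /existsP[i ai]; rewrite (bigD1 i) //= ai.
by rewrite opprD addrA subrr add0r oppr_le0.
Qed.

Lemma count_subsample m (D : m.-tuple path) (B : {set 'I_m}) (X : pred path) :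
  (count X (subsample D B))%:R = \sum_(i in B) (X (tnth D i))%:R :> R.
Proof.
rewrite /subsample count_map -sum1_count big_mkcond /= natr_sum big_enum /=.
by apply: eq_bigr => i _; case: ifP.
Qed.

Lemma size_subsample m (D : m.-tuple path) (B : {set 'I_m}) :
  size (subsample D B) = #|B|.
Proof. by rewrite size_map cardE. Qed.

Lemma count_tuple m (D : m.-tuple path) (X : pred path) :
  (count X D)%:R = \sum_(i in [set: 'I_m]) (X (tnth D i))%:R :> R.
Proof.
rewrite -sum1_count big_mkcond /= natr_sum big_tuple.
by apply: eq_big => i; rewrite ?inE // => _; case: ifP.
Qed.

Lemma notin_visited m (D : m.-tuple path) (B : {set 'I_m}) h s :
  (s \notin visited (subsample D B) h) =
  [forall i in B, ~~ at_state h s (tnth D i)].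
Proof.
rewrite inE -all_predC; apply/allP/forall_inP => [all0 i iB|all0 tau /mapP[i]].
  by apply: all0; rewrite map_f ?mem_enum.
by rewrite mem_enum => iB ->; apply: all0.
Qed.

Variables (rho : fdist R S) (Q : transitions R S A H) (piE : 'I_H -> S -> A).
Variable bc : seq path -> policy R S A H.
Variables (m n' : nat) (lam1 lam2 L t : R).
Variable x0 : S * A.

Local Notation pE := (traj_pr rho Q (det_policy R piE)).
Local Notation pB D1 := (traj_pr rho Q (bc D1)).

Definition missing_small (D1 : seq path) (h : 'I_H) (s : S) : bool :=
  (s \notin visited D1 h) ==> (prob pE (at_state h s) <= t).

Definition expert_close (D1 D1c : seq path) (h : 'I_H) (s : S) : bool :=
  `|(count (at_state_out D1 h s) D1c)%:R -
      (size D1c)%:R * prob pE (at_state_out D1 h s)| <=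
  lam2 * ((size D1c)%:R * prob pE (at_state_out D1 h s)) + L / lam2.

Definition env_close (D1 Denv : seq path) (h : 'I_H) (s : S) : bool :=
  `|(count (at_state_in D1 h s) Denv)%:R -
      (size Denv)%:R * prob (pB D1) (at_state_in D1 h s)| <=
  lam1 * ((size Denv)%:R * prob (pB D1) (at_state_in D1 h s)) + L / lam1.

Definition good_data (D1 D1c Denv : seq path) : bool :=
  [forall x : 'I_H * S, [&& missing_small D1 x.1 x.2,
    expert_close D1 D1c x.1 x.2 & env_close D1 Denv x.1 x.2]].

Hypotheses (lam1_itv : 0 < lam1 <= 3^-1) (lam2_itv : 0 < lam2 <= 3^-1).

Let pE_ge0 := traj_pr_ge0 rho Q (det_policy R piE).
Let pE_sum1 := traj_pr_sum1 rho Q (det_policy R piE) x0.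

Lemma env_close_prob D1 h s :
  \sum_(Denv : n'.-tuple path) iid (pB D1) Denv * (~~ env_close D1 Denv h s)%:R
  <= expR (- L) *+ 2.
Proof.
have /andP[l0 l3] := lam1_itv.
have := iid_deviation (traj_pr_ge0 rho Q (bc D1)) (traj_pr_sum1 rho Q (bc D1) x0)
  [set: 'I_n'] (at_state_in D1 h s) L l0 l3.
apply: le_trans; apply: ler_sum => Denv _.
by rewrite /env_close count_tuple size_tuple cardsT card_ord.
Qed.

Lemma expert_close_prob (B : {set 'I_m}) h s :
  \sum_(D : m.-tuple path) iid pE D *
    (~~ expert_close (subsample D B) (subsample D (~: B)) h s)%:R
  <= expR (- L) *+ 2.
Proof.
have /andP[l0 l3] := lam2_itv.
rewrite (iid_resample pE_sum1 B (fun D =>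
  (~~ expert_close (subsample D B) (subsample D (~: B)) h s)%:R)).
apply: (@le_trans _ _ (\sum_(D : m.-tuple path) iid pE D * (expR (- L) *+ 2)));
  last by rewrite -big_distrl /= iid_sum1 // mul1r.
apply: ler_sum => D _; rewrite ler_wpM2l ?iid_ge0 //.
have := iid_deviation pE_ge0 pE_sum1
  (~: B) (at_state_out (subsample D B) h s) L l0 l3.
apply: le_trans; apply: ler_sum => D' _.
set D'' := [tuple _ | _ < _].
have -> : subsample D'' B = subsample D B.
  apply/eq_in_map => i; rewrite mem_enum => iB.
  by rewrite tnth_mktuple iB.
have -> : subsample D'' (~: B) = subsample D' (~: B).
  apply/eq_in_map => i; rewrite mem_enum inE => iB.
  by rewrite tnth_mktuple (negbTE iB).
by rewrite /expert_close count_subsample size_subsample.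
Qed.

Lemma missing_small_prob (B : {set 'I_m}) h s : L <= t * #|B|%:R ->
  \sum_(D : m.-tuple path) iid pE D * (~~ missing_small (subsample D B) h s)%:R
  <= expR (- L).
Proof.
move=> Lt; rewrite /missing_small.
case: (leP (prob pE (at_state h s)) t) => [_|lt].
  rewrite big1 ?expR_ge0 // => D _; rewrite implybT mulr0 //.
apply: (@le_trans _ _ (expR (- (prob pE (at_state h s) * #|B|%:R)))).
  apply: le_trans (iid_miss pE_ge0 pE_sum1 B (at_state h s)).
  by apply: ler_sum => D _; rewrite implybF negbK notin_visited.
rewrite ler_expR lerN2; apply: le_trans Lt _.
by rewrite ler_wpM2r // ltW.
Qed.

Lemma good_data_prob (B : {set 'I_m}) : L <= t * #|B|%:R ->
  1 - 5 * (H%:R * #|S|%:R * expR (- L)) <=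
  \sum_(D : m.-tuple path) iid pE D *
    \sum_(Denv : n'.-tuple path) iid (pB (subsample D B)) Denv *
      (good_data (subsample D B) (subsample D (~: B)) Denv)%:R.
Proof.
move=> Lt; set q := expR (- L).
(* Rollout failures enter as the constant [2 * q]: the law of the rollouts depends on D1, so their
   probability is bounded inside, for fixed [D]. With 1 for missing states and 2 for the expert half
   this gives the 5. *)
pose X (x : 'I_H * S) (D : m.-tuple path) : R :=
  (~~ missing_small (subsample D B) x.1 x.2)%:R +
  (~~ expert_close (subsample D B) (subsample D (~: B)) x.1 x.2)%:R + 2 * q.
have XE x : \sum_(D : m.-tuple path) iid pE D * X x D <= 5 * q.
  rewrite /X; under eq_bigr do rewrite !mulrDr.
  rewrite !big_split /= -big_distrl /= iid_sum1 //.
  have := missing_small_prob x.1 x.2 Lt; have := expert_close_prob B x.1 x.2.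
  by rewrite -/q -mulr_natl; lra.
apply: le_trans (_ : \sum_(D : m.-tuple path) iid pE D * (1 - \sum_x X x D) <= _).
  have := union_bound (iid_sum1 pE_sum1 m) XE.
  by rewrite card_prod card_ord natrM; apply: le_trans; lra.
apply: ler_sum => D _; rewrite ler_wpM2l ?iid_ge0 //.
set D1 := subsample D B; set D1c := subsample D (~: B).
have pB_sum1 := iid_sum1 (traj_pr_sum1 rho Q (bc D1) x0) n'.
apply: le_trans (_ : \sum_(Denv : n'.-tuple path) iid (pB D1) Denv *
  (1 - \sum_x ((~~ missing_small D1 x.1 x.2)%:R +
     (~~ expert_close D1 D1c x.1 x.2)%:R +
     (~~ env_close D1 Denv x.1 x.2)%:R)) <= _).
  under [leRHS]eq_bigr do rewrite mulrBr mulr1 big_distrr /=.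
  rewrite sumrB pB_sum1 lerD2l lerN2 exchange_big /=; apply: ler_sum => x _.
  under eq_bigr do rewrite mulrDr.
  rewrite big_split -big_distrl /= pB_sum1 mul1r lerD2l.
  by rewrite mulr_natl; apply: env_close_prob.
apply: ler_sum => Denv _; rewrite ler_wpM2l ?iid_ge0 //.
  exact: traj_pr_ge0.
apply: le_trans (sum_prod_pred_le _); rewrite lerD2l lerN2; apply: ler_sum => x _.
by case: (missing_small _ _ _); case: (expert_close _ _ _ _);
  case: (env_close _ _ _ _) => /=; rewrite ?addr0 ?add0r // -?natrD ler_nat.
Qed.

End Sampling.

(** * Joint law of the expert data, the split, the rollouts and the exploration *)

Section JointLaw.
Variables (R : realType) (S A : finType) (H : nat).
Local Notation path := (traj S A H).
Variables (M : mdp R S A H) (piE : 'I_H -> S -> A).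
Variables (bc : seq path -> policy R S A H) (rule : sampling_rule R S A H).
Variables (m n' n : nat).

Local Notation pE := (traj_pr (init M) (trans M) (det_policy R piE)).
Local Notation pB D1 := (traj_pr (init M) (trans M) (bc D1)).

Lemma half_split_sum1 :
  \sum_(B : {set 'I_m}) (#|B| == m./2)%:R / 'C(m, m./2)%:R = 1 :> R.
Proof.
rewrite -big_distrl /= -natr_sum -big_mkcond sum1dep_card card_draws card_ord.
rewrite mulfV // pnatr_eq0 -lt0n bin_gt0.
by rewrite -{2}(odd_double_half m) -addnn addnA leq_addl.
Qed.

Lemma mbtail_prE (D : m.-tuple path) (B : {set 'I_m}) (Denv : n'.-tuple path)
    (E : n.-tuple path) :
  mbtail_pr M piE bc rule (D, B, Denv, E) =
  iid pE D * ((#|B| == m./2)%:R / 'C(m, m./2)%:R) *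
    iid (pB (subsample D B)) Denv * explore_pr M rule E.
Proof. by []. Qed.

Lemma explore_pr_ge0 (E : n.-tuple path) : 0 <= explore_pr M rule E.
Proof. by apply: prodr_ge0 => i _; apply: traj_pr_ge0. Qed.

Lemma mbtail_data_expert (D : m.-tuple path) (B B' : {set 'I_m})
    (Denv : n'.-tuple path) (E : n.-tuple path) :
  mbtail_pr M piE bc rule (D, B, Denv, E) != 0 ->
  forall tau, tau \in subsample D B' ->
  forall h, (tau h).2 = piE h (tau h).1.
Proof.
rewrite mbtail_prE !mulf_eq0 !negb_or => /andP[/andP[/andP[D0 _] _] _].
move=> tau /mapP[i _ ->] h.
apply: (@traj_pr_action _ _ _ _ (init M) (trans M) (det_policy R piE)).
  by rewrite /= eqxx.
by move: D0; rewrite /iid prodf_seq_neq0 => /allP/(_ i (mem_index_enum _)).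
Qed.

Lemma mbtail_data_env (D : m.-tuple path) (B : {set 'I_m})
    (Denv : n'.-tuple path) (E : n.-tuple path) :
  in_PiBC piE (subsample D B) (bc (subsample D B)) ->
  mbtail_pr M piE bc rule (D, B, Denv, E) != 0 ->
  forall tau, tau \in (Denv : seq path) ->
  forall h, in_Tr (subsample D B) h tau -> (tau h).2 = piE h (tau h).1.
Proof.
rewrite mbtail_prE !mulf_eq0 !negb_or => bcE /andP[/andP[_ D0] _].
move=> tau /tnthP[i ->] h inT.
apply: (@traj_pr_action _ _ _ _ (init M) (trans M) (bc (subsample D B))).
  by apply: bcE; apply: visited_path inT (leqnn h).
by move: D0; rewrite /iid prodf_seq_neq0 => /allP/(_ i (mem_index_enum _)).
Qed.

(** Exploration is independent of the other data, so the probabilities multiply, and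
    [(1 - d1) * (1 - d2) >= 1 - (d1 + d2)]. The split is independent of the expert trajectories, so
    a bound for each [B] suffices. [Ev] is asked for only on data of non-zero weight, where the
    recorded actions are known to be the expert's. *)
Lemma mbtail_pr_lower (good : seq path -> seq path -> seq path -> bool)
    (G : n.-tuple path -> Prop) (Ev : mbtail_data S A H m n' n -> Prop)
    (d1 d2 : R) :
  0 <= d1 -> 0 <= d2 <= 1 ->
  (forall B : {set 'I_m}, #|B| = m./2 ->
     1 - d1 <= \sum_(D : m.-tuple path) iid pE D *
       \sum_(Denv : n'.-tuple path) iid (pB (subsample D B)) Denv *
         (good (subsample D B) (subsample D (~: B)) Denv)%:R) ->
  1 - d2 <= Pr (@explore_pr R S A H M rule n) G ->
  (forall D B Denv E, mbtail_pr M piE bc rule (D, B, Denv, E) != 0 ->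
     #|B| = m./2 ->
     good (subsample D B) (subsample D (~: B)) Denv -> G E ->
     Ev (D, B, Denv, E)) ->
  1 - (d1 + d2) <= Pr (@mbtail_pr R S A H M piE bc rule m n' n) Ev.
Proof.
move=> d10 /andP[d20 d21] goodP GP impl.
pose p3 (u : m.-tuple path * {set 'I_m} * n'.-tuple path) : R :=
  iid pE u.1.1 * ((#|u.1.2| == m./2)%:R / 'C(m, m./2)%:R) *
  iid (pB (subsample u.1.1 u.1.2)) u.2 *
  (good (subsample u.1.1 u.1.2) (subsample u.1.1 (~: u.1.2)) u.2)%:R.
pose g (u : mbtail_data S A H m n' n) : R :=
  p3 u.1 * (explore_pr M rule u.2 * `[< G u.2 >]%:R).
apply: (@le_trans _ _ (\sum_u g u)); last first.
  rewrite PrE; apply: ler_sum => -[[[D B] Denv] E] _.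
  rewrite /g /p3 /=.
  have [z|nz] := eqVneq (mbtail_pr M piE bc rule (D, B, Denv, E)) 0.
    move: z; rewrite mbtail_prE => z.
    by rewrite mulrACA mulrA z !mul0r.
  rewrite mulrACA -mbtail_prE ler_wpM2l //.
    rewrite mbtail_prE !mulr_ge0 ?invr_ge0 ?iid_ge0 ?explore_pr_ge0 //.
      by move=> tau; apply: traj_pr_ge0.
    by move=> tau; apply: traj_pr_ge0.
  have cB : #|B| = m./2.
    move: nz; rewrite mbtail_prE; apply: contraNeq => /negbTE ->.
    by rewrite mul0r mulr0 !mul0r.
  case: (boolP (good _ _ _)) => [gd|_]; last by rewrite mul0r.
  case: (asboolP (G E)) => [GE|_]; last by rewrite mulr0.
  by rewrite mulr1; case: asboolP => // [[]]; apply: impl.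
have -> : \sum_u g u = (\sum_u p3 u) * Pr (@explore_pr R S A H M rule n) G.
  rewrite PrE big_distrl /=; under [RHS]eq_bigr do rewrite big_distrr /=.
  by rewrite pair_big.
have p3P : 1 - d1 <= \sum_u p3 u.
  have -> : \sum_u p3 u = \sum_(B : {set 'I_m})
    (#|B| == m./2)%:R / 'C(m, m./2)%:R * \sum_(D : m.-tuple path) iid pE D *
       \sum_(Denv : n'.-tuple path) iid (pB (subsample D B)) Denv *
         (good (subsample D B) (subsample D (~: B)) Denv)%:R.
    rewrite -(pair_big xpredT xpredT (fun u v => p3 (u, v))) /=.
    rewrite -(pair_big xpredT xpredT (fun D B => \sum_Denv p3 (D, B, Denv))) /=.
    rewrite exchange_big /=; apply: eq_bigr => B _.
    rewrite big_distrr /=; apply: eq_bigr => D _.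
    rewrite mulrA [X in _ = X * _]mulrC big_distrr /=.
    by apply: eq_bigr => Denv _; rewrite /p3 /= mulrA.
  rewrite -[leLHS]mul1r -[X in X * _]half_split_sum1 big_distrl /=.
  apply: ler_sum => B _; have [cB|_] := eqVneq #|B| m./2; last by rewrite !mul0r.
  by rewrite ler_wpM2l ?invr_ge0 ?mul1r // goodP.
have p30 : 0 <= \sum_u p3 u.
  apply: sumr_ge0 => u _; rewrite /p3 !mulr_ge0 ?invr_ge0 ?iid_ge0 // => tau;
    exact: traj_pr_ge0.
have := ler_wpM2l p30 GP; have d2' : 0 <= 1 - d2 by lra.
have := ler_wpM2r d2' p3P; have := mulr_ge0 d10 d20; lra.
Qed.

End JointLaw.

(** * Sample sizes and constants *)

Section Numerics.
Variable R : realType.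

(** The weights are [eps / (32 H)] for the rollouts and [1 / (2 r)] for the expert half of size [N].
    The first weight itself costs [eps / 32]; the constant 40 keeps the expert terms below
    [eps / 16], and 1024 the other rollout term below [eps / 32]. *)
Lemma estimation_budget (eps H r s L N n' : R) :
  0 < eps -> 0 < r -> H = r ^+ 2 -> 0 < N -> 0 < n' ->
  40 * (s * H * r) * L <= N * eps ->
  1024 * (s * H ^+ 2) * L <= n' * eps ^+ 2 ->
  H * (eps / (32 * H) + (2 * r)^-1 * (H * (s * (L / N))) +
    s * (L / (eps / (32 * H)) / n' + L / (2 * r)^-1 / N)) <= eps / 8.
Proof.
move=> e0 r0 HE N0 n0 hN hn; have H0 : 0 < H by rewrite HE exprn_gt0.
have -> : H * (eps / (32 * H) + (2 * r)^-1 * (H * (s * (L / N))) +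
    s * (L / (eps / (32 * H)) / n' + L / (2 * r)^-1 / N)) =
  eps / 32 + 5 / 2 * (s * H * r * L / N) + 32 * (s * H ^+ 2 * L / (eps * n')).
  rewrite HE; field.
  by rewrite !gt_eqF.
have : s * H * r * L / N <= eps / 40.
  rewrite ler_pdivrMr //; lra.
have : s * H ^+ 2 * L / (eps * n') <= eps / 1024.
  rewrite ler_pdivrMr ?mulr_gt0 //; lra.
lra.
Qed.

(** The factor 80 is twice 40 because each part holds half of the [m] trajectories; [K] pays for the
    passage from [l] to [L]. Sample sizes are positive because their lower bounds are. *)
Lemma sample_budget (eps H r s L K l m N n' : R) :
  0 < eps -> 0 < r -> H = r ^+ 2 -> 0 < s -> 0 < K -> 0 < l -> L <= K * l ->
  m = 2 * N ->
  80 * K * (s * (H * r) / eps) * l <= m ->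
  1024 * K * (s * H ^+ 2 / eps ^+ 2) * l <= n' ->
  [/\ 0 < N, 0 < n', 40 * (s * H * r) * L <= N * eps &
     1024 * (s * H ^+ 2) * L <= n' * eps ^+ 2].
Proof.
move=> e0 r0 HE s0 K0 l0 LK -> hm hn; have H0 : 0 < H by rewrite HE exprn_gt0.
have Kl : 0 < K * l by rewrite mulr_gt0.
have u0 : 0 < s * H * r by rewrite !mulr_gt0.
have v0 : 0 < s * H ^+ 2 by rewrite mulr_gt0 ?exprn_gt0.
have {}hm : 40 * ((s * H * r) * (K * l)) <= N * eps.
  rewrite -ler_pdivrMr //.
  suff -> : 40 * (s * H * r * (K * l)) / eps =
    (80 * K * (s * (H * r) / eps) * l) / 2 by lra.
  by field; rewrite gt_eqF.
have {}hn : 1024 * ((s * H ^+ 2) * (K * l)) <= n' * eps ^+ 2.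
  rewrite -ler_pdivrMr ?exprn_gt0 //; apply: le_trans hn.
  suff -> : 1024 * (s * H ^+ 2 * (K * l)) / eps ^+ 2 =
    1024 * K * (s * H ^+ 2 / eps ^+ 2) * l by [].
  by field; rewrite gt_eqF.
split.
- rewrite -(pmulr_lgt0 _ e0); apply: lt_le_trans hm.
  by rewrite mulr_gt0 ?ltr0n // mulr_gt0.
- rewrite -(pmulr_lgt0 _ (exprn_gt0 2 e0)); apply: lt_le_trans hn.
  by apply: mulr_gt0; [rewrite ltr0n|rewrite mulr_gt0].
- by apply: le_trans hm; rewrite -mulrA ler_wpM2l ?ler0n // ler_wpM2l // ltW.
- apply: le_trans hn; rewrite -mulrA; apply: ler_wpM2l; first by rewrite ler0n.
  by rewrite ler_wpM2l // ltW.
Qed.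

(** For this step size [s * a = 8 T e^2], so the terms are [16 H e] and [5/2 H e], together at most
    [20 H e]. The constant is [3200 = 160^2 / 8]. *)
Lemma regret_budget (eps H s a T : R) :
  0 < eps -> 0 < H -> 0 < s -> 0 < a -> 0 < T ->
  3200 * (s * a * H ^+ 2 / eps ^+ 2) <= T ->
  forall e, e = Num.sqrt (s * a / (8 * T)) ->
  2 * (H * s * a) / (e * T) + 5 / 2 * H * e <= eps / 8.
Proof.
move=> eps0 H0 s0 a0 T0 hT e eE.
have q0 : 0 < s * a / (8 * T) by rewrite divr_gt0 ?mulr_gt0.
have e0 : 0 < e by rewrite eE sqrtr_gt0.
have e2 : e ^+ 2 = s * a / (8 * T) by rewrite eE sqr_sqrtr // ltW.
have sa : s * a = 8 * T * e ^+ 2 by rewrite e2; field; rewrite gt_eqF.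
have -> : 2 * (H * s * a) / (e * T) = 16 * (H * e).
  have -> : H * s * a = H * (s * a) by ring.
  by rewrite sa; field; rewrite !gt_eqF.
suff : 160 * (H * e) <= eps by move=> ?; have := mulr_gt0 H0 e0; lra.
have He : 0 < 160 * (H * e) by rewrite !mulr_gt0.
rewrite -ler_sqr ?nnegrE; [|exact: ltW|exact: ltW].
rewrite !exprMn e2.
have -> : 160 ^+ 2 * (H ^+ 2 * (s * a / (8 * T))) = 3200 * (s * a * H ^+ 2) / T.
  by field; rewrite gt_eqF.
rewrite ler_pdivrMr // [leRHS]mulrC -ler_pdivrMr ?exprn_gt0 //.
by rewrite -[leLHS]mulrA.
Qed.

(** The accuracy [eps / 8] costs the factor 64. The level [k * delta] adds [ln k^-1] to the
    logarithm, and [s >= 1] lets the factor [1 + ln k^-1] absorb it. *)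
Lemma exploration_budget (c k eps delta s a H n : R) :
  0 < c -> 0 < k < 1 -> 0 < eps < 1 -> 0 < delta < 1 ->
  1 <= s -> 1 <= a -> 1 <= H ->
  64 * c * (1 + ln k^-1) * (s * a * H ^+ 3 / eps ^+ 2) *
    (s + ln (s * a * H / (delta * eps))) <= n ->
  c * (s * a * H ^+ 3 / (eps / 8) ^+ 2) * (s + ln (s * H / (k * delta))) <= n.
Proof.
move=> c0 /andP[k0 k1] /andP[e0 e1] /andP[d0 d1] s1 a1 H1 hn; apply: le_trans hn.
have s0 : 0 < s by lra.
have a0 : 0 < a by lra.
have H0 : 0 < H by lra.
have -> : s * a * H ^+ 3 / (eps / 8) ^+ 2 = 64 * (s * a * H ^+ 3 / eps ^+ 2).
  by field; rewrite gt_eqF.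
have lk : 0 <= ln k^-1 by rewrite ln_ge0 // invf_ge1 // ltW.
set Y := s * a * H ^+ 3 / eps ^+ 2.
have Y0 : 0 <= Y by rewrite divr_ge0 ?mulr_ge0 ?exprn_ge0 ?ltW.
have -> : 64 * c * (1 + ln k^-1) * Y * (s + ln (s * a * H / (delta * eps))) =
  c * (64 * Y) * ((1 + ln k^-1) * (s + ln (s * a * H / (delta * eps)))) by ring.
apply: ler_wpM2l; first by apply: mulr_ge0; [exact: ltW|exact: mulr_ge0].
have -> : s * H / (k * delta) = s * H / delta * k^-1.
  by field; rewrite !gt_eqF.
rewrite lnM ?posrE ?divr_gt0 ?mulr_gt0 ?invr_gt0 //.
have : ln (s * H / delta) <= ln (s * a * H / (delta * eps)).
  rewrite ler_ln ?posrE ?divr_gt0 ?mulr_gt0 //.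
  rewrite ler_pdivlMr ?mulr_gt0 // mulrA divfK ?gt_eqF //.
  have sH0 : 0 < s * H by rewrite mulr_gt0.
  rewrite [leRHS]mulrAC; apply: ler_wpM2l; first exact: ltW.
  lra.
have : 0 <= ln (s * H / delta).
  by rewrite ln_ge0 // ler_pdivlMr // mul1r; nra.
set l1 := ln (s * H / delta); set l2 := ln (s * a * H / _).
move=> l10 l12; have : 0 <= ln k^-1 * (s - 1) by rewrite mulr_ge0 ?subr_ge0.
have : 0 <= ln k^-1 * l2 by rewrite mulr_ge0 // (le_trans l10).
lra.
Qed.

(** [L] makes five failures of size [exp (- L)] per step and state cost [(1 - k) * delta] in all. As
    [s * H / delta >= 5], its logarithm is at least [ln 5], so the additive constant
    [ln (5 / (1 - k))] turns into a factor. *)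
Lemma confidence_level (k delta s H L : R) :
  0 < k < 1 -> 0 < delta < 1 -> 1 <= s -> 5 <= H ->
  L = ln (5 * (H * s) / ((1 - k) * delta)) ->
  [/\ 0 < ln (s * H / delta),
      5 * (H * s * expR (- L)) = (1 - k) * delta &
      L <= (1 + ln (5 / (1 - k)) / ln 5) * ln (s * H / delta)].
Proof.
move=> /andP[k0 k1] /andP[d0 d1] s1 H5 ->.
have k' : 0 < 1 - k by lra.
have sH : 5 <= s * H by nra.
have sHd : 5 <= s * H / delta by rewrite ler_pdivlMr //; nra.
have ln5 : 0 < ln 5 :> R by rewrite ln_gt0 // ltr1n.
have lnle : ln 5 <= ln (s * H / delta) by rewrite ler_ln ?posrE //; lra.
split; first exact: lt_le_trans lnle.
  rewrite expRN lnK; last by rewrite posrE divr_gt0 ?mulr_gt0 //; lra.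
  by field; rewrite !gt_eqF //; lra.
have -> : 5 * (H * s) / ((1 - k) * delta) = 5 / (1 - k) * (s * H / delta).
  by field; rewrite !gt_eqF.
have sHp : 0 < s * H by lra.
rewrite [leLHS]lnM ?posrE ?divr_gt0 //.
have : 0 <= ln (5 / (1 - k)) by rewrite ln_ge0 // ler_pdivlMr //; lra.
set x := ln (5 / (1 - k)); set l := ln (s * H / delta) in lnle * => x0.
have -> : (1 + x / ln 5) * l = l + x * l / ln 5 by field; rewrite gt_eqF.
by rewrite [leLHS]addrC lerD2l ler_pdivlMr // ler_wpM2l.
Qed.
End Numerics.

Lemma powR_three_halves (R : realType) (x : R) :
  0 <= x -> powR x (3 / 2) = x * Num.sqrt x.
Proof.
move=> x0; have -> : 3 / 2 = 1 + 2^-1 :> R by field.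
rewrite powRD; last by rewrite gt_eqF //; lra.
by rewrite powRr1 // powR12_sqrt.
Qed.

(* [c] is the universal constant of the reward-free exploration guarantee and
   [k * delta] the confidence parameter handed to that method. *)
Theorem theorem8 (R : realType) (c k : R) (c_gt0 : 0 < c) (k_itv : 0 < k < 1) :
  exists C1 C2 C3 C4 : R,
  [/\ 0 < C1, 0 < C2, 0 < C3 & 0 < C4] /\
  forall (S A : finType) (H : nat) (M : mdp R S A H) (piE : 'I_H -> S -> A)
    (bc : seq (traj S A H) -> policy R S A H)
    (rfe : R -> sampling_rule R S A H)
    (eps delta eps_opt : R) (T m n' n : nat) (eta : nat -> R),
  0 < eps < 1 -> 0 < delta < 1 -> (5 <= H)%N ->
  (forall D1 : seq (traj S A H), in_PiBC piE D1 (bc D1)) ->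
  reward_free_guarantee c M rfe ->
  eps_opt <= eps / 2 ->
  C1 * (#|S|%:R * #|A|%:R * H%:R ^+ 2 / eps ^+ 2) <= T%:R ->
  (forall t : nat, eta t = Num.sqrt (#|S|%:R * #|A|%:R / (8 * T%:R))) ->
  ~~ odd m ->
  C2 * (#|S|%:R * powR H%:R (3 / 2) / eps) * ln (#|S|%:R * H%:R / delta)
    <= m%:R ->
  C3 * (#|S|%:R * H%:R ^+ 2 / eps ^+ 2) * ln (#|S|%:R * H%:R / delta)
    <= n'%:R ->
  C4 * (#|S|%:R * #|A|%:R * H%:R ^+ 3 / eps ^+ 2) *
    (#|S|%:R + ln (#|S|%:R * #|A|%:R * H%:R / (delta * eps))) <= n%:R ->
  1 - delta <=
  Pr (@mbtail_pr R S A H M piE bc (rfe (k * delta)) m n' n) (fun omega =>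
    forall pibar : policy R S A H,
      MBTAIL_output (init M) eps_opt T eta omega pibar ->
      value (init M) (trans M) (reward M) (det_policy R piE) -
        value (init M) (trans M) (reward M) pibar <= eps).
Proof.
have /andP[k0 k1] := k_itv.
pose K : R := 1 + ln (5 / (1 - k)) / ln 5.
have k' : 0 < 1 - k by lra.
have K0 : 0 < K.
  rewrite ltr_pwDl // divr_ge0 // ln_ge0 // ?ler1n //.
  by rewrite ler_pdivlMr //; lra.
have lk0 : 0 <= ln k^-1 by rewrite ln_ge0 // invf_ge1 // ltW.
exists 3200, (80 * K), (1024 * K), (64 * c * (1 + ln k^-1)).
have lk1 : 0 < 1 + ln k^-1 by lra.
split; first by split; rewrite ?mulr_gt0 ?ltr0n.
move=> S A H M piE bc rfe eps delta eps_opt T m n' n eta eps_itv delta_itv H5.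
move=> bcE rfeG opt_le hT etaE m_even hm hn' hn.
have /andP[e0 e1] := eps_itv; have /andP[d0 d1] := delta_itv.
(* The initial law has mass 1, which forces a state to exist; the expert then supplies an action,
   and [x0] can serve as the pinning value. *)
have [s0 _] : exists s : S, true.
  case: (pickP (fun s : S => true)) => [s _|none]; first by exists s.
  have := fdist_sum1 (init M); rewrite big_pred0 // => /eqP.
  by rewrite eq_sym oner_eq0.
pose h0 : 'I_H := Ordinal (leq_trans (isT : (0 < 5)%N) H5).
pose x0 := (s0, piE h0 s0).
have s1 : 1 <= #|S|%:R :> R by rewrite ler1n; apply/card_gt0P; exists s0.
have a1 : 1 <= #|A|%:R :> R by rewrite ler1n; apply/card_gt0P; exists x0.2.
have HR5 : 5 <= H%:R :> R by rewrite ler_nat.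
set s : R := #|S|%:R in s1 hT etaE hm hn' hn *.
set a : R := #|A|%:R in a1 hT etaE hn *.
set Hr : R := H%:R in HR5 hT hm hn' hn *.
have sp : 0 < s by apply: lt_le_trans s1.
have ap : 0 < a by apply: lt_le_trans a1.
have Hp : 0 < Hr by apply: lt_le_trans HR5; rewrite ltr0n.
pose L := ln (5 * (Hr * s) / ((1 - k) * delta)).
have [l0 expL LK] := confidence_level k_itv delta_itv s1 HR5 (erefl L).
rewrite -/K in LK; set l := ln (s * Hr / delta) in l0 LK hm hn'.
have r0 : 0 < Num.sqrt Hr by rewrite sqrtr_gt0.
have HrE : Hr = Num.sqrt Hr ^+ 2 by rewrite sqr_sqrtr // ltW.
rewrite powR_three_halves in hm; last exact: ltW.
have mE : m%:R = 2 * (m./2)%:R :> R.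
  by rewrite -{1}(odd_double_half m) (negbTE m_even) add0n -mul2n natrM.
have [N0 n'0 budgetN budgetn'] :=
  sample_budget e0 r0 HrE sp K0 l0 LK mE hm hn'.
have T0 : 0 < T%:R :> R.
  apply: lt_le_trans hT; apply: mulr_gt0; first by rewrite ltr0n.
  by rewrite divr_gt0 ?mulr_gt0 ?exprn_gt0.
have regret := regret_budget e0 Hp sp ap T0 hT.
have exploration := exploration_budget c_gt0 k_itv eps_itv delta_itv s1 a1
  (le_trans (ler1n _ 5) HR5) hn.
clear hm hn' hT hn.
(* [lam2] balances [lam2 * H] against [1 / lam2] up to constants; its factor 2 ensures [lam2 <= 1/3]
   already at [H = 5]. The threshold [t] satisfies [t * #|B| = L] for a half [B]. *)
pose lam1 := eps / (32 * Hr); pose lam2 := (2 * Num.sqrt Hr)^-1.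
pose t := L / (m./2)%:R.
have lam1_itv : 0 < lam1 <= 3^-1.
  rewrite divr_gt0 ?mulr_gt0 // ler_pdivrMr ?mulr_gt0 //; lra.
have lam2_itv : 0 < lam2 <= 3^-1.
  rewrite invr_gt0 mulr_gt0 // lef_pV2 ?posrE ?mulr_gt0 //.
  rewrite -ler_sqr ?nnegrE; [|by []|by rewrite mulr_ge0 // ltW].
  by rewrite exprMn -HrE; lra.
have L0 : 0 <= L.
  rewrite ln_ge0 // ler_pdivlMr ?mulr_gt0 // mul1r; nra.
have t0 : 0 <= t by rewrite divr_ge0 // ltW.
have budget : Hr * (lam1 + lam2 * (Hr * (s * t)) +
    s * (L / lam1 / n'%:R + L / lam2 / (m./2)%:R)) <= eps / 8.
  exact: (estimation_budget e0 r0 HrE N0 n'0 budgetN budgetn').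
clear budgetN budgetn'.
(* The failure probability is shared between expert data with rollouts, [(1 - k) * delta], and
   exploration, [k * delta]. *)
have deltaE : 1 - delta = 1 - ((1 - k) * delta + k * delta) by ring.
rewrite deltaE.
have kd_itv : 0 < k * delta < 1 by rewrite mulr_gt0 //=; nra.
have eps8_itv : 0 < eps / 8 < 1 by apply/andP; split; lra.
pose G (E : n.-tuple (traj S A H)) := forall (pi : policy R S A H) w, in_W w ->
  `|value (init M) (trans M) w pi - value (init M) (Phat R E) w pi|
    <= eps / 8 / 2.
apply: (@mbtail_pr_lower _ _ _ _ M piE bc (rfe (k * delta)) m n' n
  (good_data (init M) (trans M) piE bc lam1 lam2 L t) G).
- by rewrite mulr_ge0 // ltW.
- by case/andP: kd_itv => ? ?; apply/andP; split; apply: ltW.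
- move=> B cB; rewrite -expL.
  apply: good_data_prob => //.
  by rewrite cB /t divfK // gt_eqF.
- apply: (rfeG (eps / 8) (k * delta) n eps8_itv kd_itv).
  exact: exploration.
move=> D B Denv E nz cB gd GE pibar out.
have cBc : #|~: B| = m./2.
  rewrite cardsCs finset.setCK card_ord cB -{1}(odd_double_half m).
  by rewrite (negbTE m_even) add0n -addnn addnK.
have Nn : (0 < m./2)%N by rewrite -(ltr0n R).
have n'n : (0 < n')%N by rewrite -(ltr0n R).
have Tn : (0 < T)%N by rewrite -(ltr0n R).
have gdx h s' : [&& missing_small (init M) (trans M) piE t (subsample D B) h s',
    expert_close (init M) (trans M) piE lam2 L (subsample D B)
      (subsample D (~: B)) h s' &
    env_close (init M) (trans M) bc lam1 L (subsample D B) Denv h s'].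
  by move/forallP: gd => /(_ (h, s')).
have err : \sum_h \sum_s \sum_a
   `|Ptilde R (subsample D B) (subsample D (~: B)) Denv h s a -
     occupancy (init M) (trans M) (det_policy R piE) h s a| <= eps / 8.
  apply: le_trans budget.
  apply: (@estimation_error _ _ _ _ (init M) (trans M) piE (subsample D B)
    (bc (subsample D B))) => //.
  - by apply: mbtail_data_expert nz.
  - by apply: mbtail_data_env nz.
  - exact: size_tuple.
  - by rewrite size_subsample.
  - by case/andP: lam1_itv => /ltW.
  - by case/andP: lam2_itv => /ltW.
  - by move=> h s' out'; case/and3P: (gdx h s') => /implyP/(_ out').
  - by move=> h s'; case/and3P: (gdx h s') => _ _; rewrite /env_close size_tuple.
  - move=> h s'; case/and3P: (gdx h s') => _.
    by rewrite /expert_close size_subsample cBc.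
set e := Num.sqrt (s * a / (8 * T%:R)) in etaE.
have eP : 0 < e by rewrite sqrtr_gt0 divr_gt0 ?mulr_gt0.
have rW : in_W (reward M).
  move=> h s' a'; have /andP[r1 r2] := reward_itv M h s' a'.
  by rewrite ger0_norm.
(* The budget is exact: [2 * (eps / 8)] for estimation, [2 * (eps / 16)] for the model, [eps / 2]
   for optimization and [eps / 8] for the regret add up to [eps]. *)
have := imitation_gap x0 Tn eP etaE rW (Ptilde_ge0 R _ _ _)
  (Ptilde_mass R _ _ _) GE err out.
have := regret e (erefl e).
rewrite -/s -/a -/Hr; lra.
Qed.
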